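(* Let $\mathbb{K}$ be any field, let $n\in\mathbb{Z}_{>0}$ and $r\in\mathbb{Z}$ with $1\le r\le n$, and let $\mathcal{U}_{[n]}^r=\{F\subseteq[n] : \#F\le r\}$ be the uniform matroid of rank $r$ on $[n]=\{1,\dots,n\}$. For every $\mathbf{b}\in\{0,1\}^n$, with $\#\mathbf{b}$ denoting the cardinality of its support, $$\dim_{\mathbb{K}}T^2_{-\mathbf{b}}(\mathcal{U}_{[n]}^r)=\begin{cases}0 & \text{if }\#\mathbf{b}\neq 2\text{ or }r\ge n-1,\\ r\binom{n-2}{r}-\binom{n-2}{r-1} & \text{if }\#\mathbf{b}=2\text{ and }r\le n-2.\end{cases}$$ In particular, $T^2_{-\mathbf{b}}(\mathcal{U}_{[n]}^r)=0$ for all $\mathbf{b}\in\{0,1\}^n$ if and only if $r\ge n-2$, that is, if and only if the matroid is a full simplex, the boundary of a full simplex, or the uniform matroid $\mathcal{U}_{[n]}^{n-2}$.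
   Context: For a simplicial complex $\Delta$ on $[n]$ (a family of subsets of $[n]$ closed under taking subsets), $T^2(\Delta)$ is the second cotangent cohomology module of the Stanley-Reisner ring $S/I_\Delta$, where $S=\mathbb{K}[x_1,\dots,x_n]$ and $I=I_\Delta=\langle\prod_{i\in F}x_i : F\subseteq[n],\ F\notin\Delta\rangle$. Explicitly: let $m$ be the number of minimal monomial generators of $I$, let $d:S^m\to S$ be the $S$-linear map sending the canonical basis to these generators, $\operatorname{Syz}(I)=\ker d$, and $\operatorname{Kosz}(I)\subseteq\operatorname{Syz}(I)$ the submodule generated by all $d(f)g-d(g)f$ with $f,g\in S^m$. The quotient $\operatorname{Syz}(I)/\operatorname{Kosz}(I)$ is an $S/I$-module, and $T^2(\Delta)$ is the cokernel of the induced (restriction) map $\operatorname{Hom}_S(S^m,S/I)\to\operatorname{Hom}_{S/I}(\operatorname{Syz}(I)/\operatorname{Kosz}(I),S/I)$. Since $I$ is a monomial ideal, all these modules are $\mathbb{Z}^n$-graded ($\deg x_i=e_i$, with the basis elements of $S^m$ placed in degrees making $d$ homogeneous of degree $0$, and a homomorphism having degree $\mathbf{c}$ if it shifts degrees by $\mathbf{c}$). $T^2_{\mathbf{c}}(\Delta)$ denotes the component of degree $\mathbf{c}\in\mathbb{Z}^n$. The binomial coefficient $\binom{k}{i}$ is the number of $i$-subsets of a $k$-element set. *)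

(* Defs.v *)
From HB Require Import structures.
From mathcomp Require Import all_boot all_order all_algebra.
From mathcomp Require Import generic_quotient ring_quotient.
From mathcomp Require Import mpoly.
From mathcomp Require Import boolp functions.

Set Implicit Arguments.
Unset Strict Implicit.
Unset Printing Implicit Defensive.

Import GRing.Theory.

Local Open Scope ring_scope.
Local Open Scope quotient_scope.

(** * Submodules, quotient modules, quotient rings, Hom modules *)

Section Submodule.
Variables (R : pzRingType) (M : lmodType R) (N : submodClosed M).

Definition submodule := {x : M | x \in N}.
HB.instance Definition _ := SubChoice.on submodule.
HB.instance Definition _ := [SubChoice_isSubLmodule of submodule by <:].

Lemma submoduleDE (x y : submodule) : val (x + y) = val x + val y.
Proof. by []. Qed.
Lemma submoduleZE (a : R) (x : submodule) : val (a *: x) = a *: val x.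
Proof. by []. Qed.
End Submodule.

Section GeneratedSubmodule.
Variables (R : pzRingType) (M : lmodType R) (X : M -> Prop).

Definition in_genmod (v : M) : Prop :=
  exists (k : nat) (a : 'I_k -> R) (x : 'I_k -> M),
    (forall i, X (x i)) /\ v = \sum_i a i *: x i.

Definition genmod : {pred M} := fun v => `[< in_genmod v >].

Lemma genmodP v : reflect (in_genmod v) (v \in genmod).
Proof. exact: asboolP. Qed.

Lemma genmod_subsemimod_closed : subsemimod_closed genmod.
Proof.
split; first split.
- apply/genmodP; exists 0%N, (fun=> 0), (fun=> 0); split; first by case.
  by rewrite big_ord0.
- move=> u v /genmodP[k [a [x [Xx ->]]]] /genmodP[l [b [y [Xy ->]]]].
  apply/genmodP; exists (k + l)%N.
  exists (fun i => match fintype.split i with inl j => a j | inr j => b j end).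
  exists (fun i => match fintype.split i with inl j => x j | inr j => y j end).
  split; first by move=> i; case: (fintype.split i).
  rewrite big_split_ord /=; congr (_ + _); apply: eq_bigr => i _.
    by rewrite (unsplitK (inl i)).
  by rewrite (unsplitK (inr i)).
move=> c v /genmodP[k [a [x [Xx ->]]]].
apply/genmodP; exists k, (fun i => c * a i), x; split=> //.
by rewrite scaler_sumr; apply: eq_bigr => i _; rewrite scalerA.
Qed.

HB.instance Definition _ :=
  GRing.isSubmodClosed.Build R M genmod genmod_subsemimod_closed.

Lemma mem_genmod v : X v -> v \in genmod.
Proof.
move=> Xv; apply/genmodP; exists 1%N, (fun=> 1), (fun=> v).
by rewrite big_ord1 scale1r.
Qed.
End GeneratedSubmodule.

Section QuotientModule.
Variables (R : pzRingType) (M : lmodType R) (N : submodClosed M).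

(* For a ring R, the structure submodClosed does not record closure under     *)
(* opposite, which the additive quotient of the library needs.                *)
Definition submod_pred : {pred M} := N.

Fact submod_pred_zmod_closed : zmod_closed submod_pred.
Proof.
split=> [|u v uN vN]; first exact: (rpred0 N).
by rewrite -scaleN1r; apply: (@rpredD _ N); last exact: (@rpredZ _ _ N).
Qed.
HB.instance Definition _ :=
  GRing.isZmodClosed.Build M submod_pred submod_pred_zmod_closed.

Definition quomod := Quotient.quot submod_pred.
HB.instance Definition _ := EqQuotient.on quomod.
HB.instance Definition _ := Choice.on quomod.
HB.instance Definition _ := GRing.Zmodule.on quomod.

Definition quoproj (v : M) : quomod := \pi_quomod v.

Lemma quoproj_eq (u v : M) : (quoproj u == quoproj v) = (u - v \in N).
Proof. exact/esym/(Quotient.idealrBE submod_pred). Qed.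

Lemma quoproj_repr (x : quomod) : quoproj (repr x) = x.
Proof. exact: reprK. Qed.

Lemma quoproj_surj (x : quomod) : exists v, x = quoproj v.
Proof. by exists (repr x); rewrite quoproj_repr. Qed.

Lemma quoproj_is_zmod_morphism : zmod_morphism quoproj.
Proof. by move=> u v; rewrite /quoproj raddfB. Qed.
HB.instance Definition _ :=
  GRing.isZmodMorphism.Build M quomod quoproj quoproj_is_zmod_morphism.

Definition quoscale (a : R) (x : quomod) : quomod := quoproj (a *: repr x).

Lemma quoscaleE a v : quoscale a (quoproj v) = quoproj (a *: v).
Proof.
apply/eqP; rewrite quoproj_eq -scalerBr rpredZ // -quoproj_eq.
by rewrite quoproj_repr.
Qed.

Fact quoscaleA a b x : quoscale a (quoscale b x) = quoscale (a * b) x.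
Proof. by rewrite {2}/quoscale quoscaleE scalerA. Qed.
Fact quoscale1 : left_id 1 quoscale.
Proof. by move=> x; rewrite /quoscale scale1r quoproj_repr. Qed.
Fact quoscaleDr : right_distributive quoscale +%R.
Proof.
move=> a x y; rewrite -[x]quoproj_repr -[y]quoproj_repr -raddfD.
by rewrite !quoscaleE scalerDr raddfD.
Qed.
Fact quoscaleDl x : {morph quoscale^~ x : a b / a + b}.
Proof. by move=> a b; rewrite /quoscale scalerDl raddfD. Qed.

HB.instance Definition _ := GRing.Zmodule_isLmodule.Build R quomod
  quoscaleA quoscale1 quoscaleDr quoscaleDl.

Lemma quoproj_is_scalable : scalable quoproj.
Proof. by move=> a v; rewrite -quoscaleE. Qed.
HB.instance Definition _ :=
  GRing.isScalable.Build R M quomod *:%R quoproj quoproj_is_scalable.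

Lemma quoproj0 : quoproj 0 = 0.
Proof. exact: raddf0. Qed.
Lemma quoproj_eq0 v : (quoproj v == 0) = (v \in N).
Proof. by rewrite -quoproj0 quoproj_eq subr0. Qed.
End QuotientModule.

(* Ideals of R are the submodules of R^o. Improper ideals are allowed, which  *)
(* is why {ideal_quot _} is not used.                                         *)
Section QuotientRing.
Variables (R : comPzRingType) (I : submodClosed R^o).
Implicit Types x y z : quomod I.

Local Notation pr := (@quoproj R R^o I).

Definition quomul x y : quomod I := (repr x : R) *: y.

Lemma quomulE (a b : R) : quomul (pr a) (pr b) = pr (a * b).
Proof.
rewrite /quomul -linearZ; apply/eqP; rewrite quoproj_eq.
have -> : (repr (pr a) : R) *: (b : R^o) - a * b =
          b *: ((repr (pr a) : R^o) - a).
  by rewrite /GRing.scale /= mulrBr ![b * _]mulrC.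
by apply: rpredZ; rewrite -quoproj_eq quoproj_repr.
Qed.

Fact quomulA : associative quomul.
Proof.
move=> x y z; have [a ->] := quoproj_surj x; have [b ->] := quoproj_surj y.
have [c ->] := quoproj_surj z.
by rewrite (quomulE b c) (quomulE a b) (quomulE a) (quomulE _ c) mulrA.
Qed.
Fact quomulC : commutative quomul.
Proof.
move=> x y; have [a ->] := quoproj_surj x; have [b ->] := quoproj_surj y.
by rewrite (quomulE a b) (quomulE b a) mulrC.
Qed.
Fact quomul1 : left_id (pr 1) quomul.
Proof. by move=> x; have [a ->] := quoproj_surj x; rewrite (quomulE 1 a) mul1r. Qed.
Fact quomulDl : left_distributive quomul +%R.
Proof. by move=> x y z; rewrite ![quomul _ z]quomulC /quomul scalerDr. Qed.

Definition quoring := quomod I.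
HB.instance Definition _ := GRing.Zmodule.on quoring.
HB.instance Definition _ := GRing.Zmodule_isComPzRing.Build quoring
  quomulA quomulC quomul1 quomulDl.

Definition quoring_proj (a : R) : quoring := pr a.

Lemma quoring_proj_surj (x : quoring) : exists a, x = quoring_proj a.
Proof. exact: (quoproj_surj (x : quomod I)). Qed.

Fact quoring_proj_is_zmod_morphism : zmod_morphism quoring_proj.
Proof. by move=> a b; rewrite /quoring_proj raddfB. Qed.
Fact quoring_proj_is_monoid_morphism : monoid_morphism quoring_proj.
Proof. by split=> [|a b] //; apply/esym/(quomulE a b). Qed.
HB.instance Definition _ := GRing.isZmodMorphism.Build R quoring
  quoring_proj quoring_proj_is_zmod_morphism.
HB.instance Definition _ := GRing.isMonoidMorphism.Build R quoring
  quoring_proj quoring_proj_is_monoid_morphism.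
End QuotientRing.

(* An R-module killed by the ideal I, seen as an R/I-module. *)
Section AnnihilatedModule.
Variables (R : comPzRingType) (I : submodClosed R^o) (M : lmodType R).
Hypothesis IM0 : forall (a : R) (v : M), a \in I -> a *: v = 0.

Definition annmod of (forall (a : R) (v : M), a \in I -> a *: v = 0) : Type :=
  M.
Local Notation M' := (annmod IM0).
HB.instance Definition _ := GRing.Zmodule.on M'.

Definition annscale (x : quoring I) (v : M') : M' :=
  (repr (x : quomod I) : R) *: (v : M).

Lemma annscaleE (a : R) (v : M) :
  annscale (quoring_proj I a) v = (a *: v : M).
Proof.
have := quoproj_eq I (repr (quoring_proj I a : quomod I)) a.
rewrite quoproj_repr eqxx => /esym memI.
by apply/eqP; rewrite -subr_eq0 /annscale -scalerBl IM0.
Qed.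

Fact annscaleA x y v : annscale x (annscale y v) = annscale (x * y) v.
Proof.
have [a ->] := quoring_proj_surj x; have [b ->] := quoring_proj_surj y.
by rewrite -rmorphM (annscaleE b) (annscaleE a) (annscaleE (a * b)) scalerA.
Qed.
Fact annscale1 : left_id 1 annscale.
Proof. by move=> v; rewrite -(rmorph1 (quoring_proj I)) annscaleE scale1r. Qed.
Fact annscaleDr : right_distributive annscale +%R.
Proof. by move=> x u v; rewrite /annscale scalerDr. Qed.
Fact annscaleDl v : {morph annscale^~ v : x y / x + y}.
Proof.
move=> x y.
have [a ->] := quoring_proj_surj x; have [b ->] := quoring_proj_surj y.
by rewrite -rmorphD (annscaleE b) (annscaleE a) (annscaleE (a + b)) scalerDl.
Qed.

HB.instance Definition _ := GRing.Zmodule_isLmodule.Build (quoring I) M'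
  annscaleA annscale1 annscaleDr annscaleDl.
End AnnihilatedModule.

Section RestrictionOfScalars.
Variables (A B : pzRingType) (f : {rmorphism A -> B}) (M : lmodType B).

Definition restr_scalars of {rmorphism A -> B} : Type := M.
Local Notation M' := (restr_scalars f).
HB.instance Definition _ := GRing.Zmodule.on M'.

Definition rescale (a : A) (v : M') : M' := f a *: (v : M).

Fact rescaleA a b v : rescale a (rescale b v) = rescale (a * b) v.
Proof. by rewrite /rescale scalerA rmorphM. Qed.
Fact rescale1 : left_id 1 rescale.
Proof. by move=> v; rewrite /rescale rmorph1 scale1r. Qed.
Fact rescaleDr : right_distributive rescale +%R.
Proof. by move=> a u v; rewrite /rescale scalerDr. Qed.
Fact rescaleDl v : {morph rescale^~ v : a b / a + b}.
Proof. by move=> a b; rewrite /rescale rmorphD scalerDl. Qed.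

HB.instance Definition _ := GRing.Zmodule_isLmodule.Build A M'
  rescaleA rescale1 rescaleDr rescaleDl.

Lemma restr_scalarsE (a : A) (v : M') : a *: v = f a *: (v : M) :> M.
Proof. by []. Qed.
End RestrictionOfScalars.

Section HomModule.
Variables (A : comPzRingType) (M N : lmodType A).

Definition is_linear : {pred M -> N} := fun f => `[< linear f >].

Lemma is_linearP f : reflect (linear f) (f \in is_linear).
Proof. exact: asboolP. Qed.

Lemma is_linear_subsemimod_closed : subsemimod_closed is_linear.
Proof.
split; first split.
- apply/is_linearP => a u v.
  by rewrite -[LHS]/(0 : N) -[RHS]/(a *: (0 : N) + 0) scaler0 addr0.
- move=> f g /is_linearP lf /is_linearP lg; apply/is_linearP => a u v.
  rewrite -[LHS]/(f (a *: u + v) + g (a *: u + v)).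
  by rewrite -[RHS]/(a *: (f u + g u) + (f v + g v)) lf lg scalerDr addrACA.
move=> c f /is_linearP lf; apply/is_linearP => a u v.
rewrite -[LHS]/(c *: f (a *: u + v)) -[RHS]/(a *: (c *: f u) + c *: f v).
by rewrite lf scalerDr !scalerA mulrC.
Qed.

HB.instance Definition _ :=
  GRing.isSubmodClosed.Build A (M -> N) is_linear is_linear_subsemimod_closed.

Definition homs := submodule is_linear.
HB.instance Definition _ := GRing.Lmodule.on homs.

Definition hom_fun (f : homs) : M -> N := val f.
Coercion hom_fun : homs >-> Funclass.

Fact hom_fun_is_linear (f : homs) : linear f.
Proof. exact/is_linearP/(valP f). Qed.
HB.instance Definition _ f :=
  GRing.isLinear.Build A M N *:%R (hom_fun f) (hom_fun_is_linear f).

Definition mk_hom (f : M -> N) (lf : linear f) : homs :=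
  exist _ f (introT (is_linearP f) lf).

Lemma homs_eqP (f g : homs) : f =1 g -> f = g.
Proof. by move=> fg; apply/val_inj/funext. Qed.

Lemma homs0E (x : M) : hom_fun 0 x = 0.
Proof. by []. Qed.
Lemma homsDE (f g : homs) (x : M) : hom_fun (f + g) x = f x + g x.
Proof. by []. Qed.
Lemma homsZE (a : A) (f : homs) (x : M) : hom_fun (a *: f) x = a *: f x.
Proof. by []. Qed.
End HomModule.

(* V is K-linearly isomorphic to K^d; V itself need not carry a vectType.      *)
Definition has_dim (K : fieldType) (d : nat) (V : lmodType K) : Prop :=
  inhabited (Vector.axiom d V).

Section SecondCotangent.
Variables (K : fieldType) (n : nat) (Delta : {set {set 'I_n}}).

Local Notation S := {mpoly K[n]}.

Definition sqfree_monomial (F : {set 'I_n}) : S := \prod_(i in F) 'X_i.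

Definition SR_ideal : {pred S^o} :=
  genmod (fun p : S^o => exists2 F, F \notin Delta & p = sqfree_monomial F).
HB.instance Definition _ := GRing.SubmodClosed.on SR_ideal.

Definition SR_ring := quoring SR_ideal.
HB.instance Definition _ := GRing.ComPzRing.on SR_ring.
Local Notation prS := (quoring_proj SR_ideal).

(* As \prod_(i in G) x_i divides \prod_(i in F) x_i iff G \subset F, the      *)
(* minimal monomial generators of I are the monomials of the minimal nonfaces.*)
Definition min_nonfaces : {set {set 'I_n}} :=
  [set F | minset [pred G | G \notin Delta] F].

Definition ngens : nat := #|min_nonfaces|.
Definition gen_support (j : 'I_ngens) : {set 'I_n} := enum_val j.
Definition gen (j : 'I_ngens) : S := sqfree_monomial (gen_support j).

Definition gen_map (f : 'rV[S]_ngens) : S^o := \sum_j f 0 j * gen j.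

Fact gen_map_is_linear : linear gen_map.
Proof.
move=> a f g; rewrite /gen_map /GRing.scale /= mulr_sumr -big_split /=.
by apply: eq_bigr => j _; rewrite !mxE mulrDl mulrA.
Qed.
HB.instance Definition _ := GRing.isLinear.Build S 'rV[S]_ngens S^o *:%R
  gen_map gen_map_is_linear.

Lemma gen_mapZ a f : gen_map (a *: f) = a *: gen_map f.
Proof. exact: linearZ. Qed.

Definition Syz_pred : {pred 'rV[S]_ngens} := [pred f | gen_map f == 0].

Lemma Syz_predP f : reflect (gen_map f = 0) (f \in Syz_pred).
Proof. exact: eqP. Qed.

Fact Syz_subsemimod_closed : subsemimod_closed Syz_pred.
Proof.
split; first split.
- exact/Syz_predP/raddf0.
- move=> f g /Syz_predP f0 /Syz_predP g0; apply/Syz_predP.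
  by rewrite raddfD /= f0 g0 addr0.
by move=> a f /Syz_predP f0; apply/Syz_predP; rewrite linearZ /= f0 scaler0.
Qed.
HB.instance Definition _ := GRing.isSubmodClosed.Build S 'rV[S]_ngens
  Syz_pred Syz_subsemimod_closed.

Definition Syz := submodule Syz_pred.
HB.instance Definition _ := GRing.Lmodule.on Syz.
HB.instance Definition _ := SubType.on Syz.

Definition Kosz : {pred Syz} :=
  genmod (fun z : Syz => exists f g : 'rV[S]_ngens,
    val z = (gen_map f : S) *: g - (gen_map g : S) *: f).
HB.instance Definition _ := GRing.SubmodClosed.on Kosz.

Lemma sqfree_monomial_gen (F : {set 'I_n}) :
  F \notin Delta -> exists f, sqfree_monomial F = gen_map f.
Proof.
move=> FnD; have [G minG sGF] := @minset_exists _ [pred G | G \notin Delta] F FnD.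
have Gmin : G \in min_nonfaces by rewrite inE.
pose j : 'I_ngens := enum_rank_in Gmin G.
have jG : gen_support j = G by rewrite /gen_support enum_rankK_in.
exists (\row_k if k == j then sqfree_monomial (F :\: G) else 0).
rewrite /gen_map (bigD1 j) //= big1 ?addr0 => [|k /negPf kj]; last first.
  by rewrite mxE kj mul0r.
rewrite mxE eqxx /gen jG /sqfree_monomial mulrC.
by rewrite (big_setID G) /= (setIidPr sGF).
Qed.

Lemma SR_ideal_gen (a : S) : a \in SR_ideal -> exists f, a = gen_map f.
Proof.
move=> /genmodP[k [b [x [Xx ->]]]].
have /choice[f fE] : forall i, exists f, x i = gen_map f.
  by move=> i; have [F FnD ->] := Xx i; apply: sqfree_monomial_gen.
exists (\sum_i b i *: f i); rewrite raddf_sum.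
by apply: eq_bigr => i _; rewrite fE -gen_mapZ.
Qed.

Fact SR_ideal_Syz_Kosz (a : S) (x : quomod Kosz) : a \in SR_ideal -> a *: x = 0.
Proof.
move=> /SR_ideal_gen[f ->]; have [z ->] := quoproj_surj x.
rewrite -linearZ -(raddf0 (quoproj Kosz)); apply/eqP.
rewrite (quoproj_eq Kosz) subr0; apply: mem_genmod; exists f, (val z).
by have /Syz_predP -> := valP z; rewrite scale0r subr0.
Qed.

Definition SyzKosz := annmod SR_ideal_Syz_Kosz.
HB.instance Definition _ := GRing.Lmodule.on SyzKosz.

Definition Syz_class (z : Syz) : SyzKosz := quoproj Kosz z.

Lemma Syz_class_surj (x : SyzKosz) : exists z, x = Syz_class z.
Proof. exact: (quoproj_surj (x : quomod Kosz)). Qed.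

Lemma Syz_classP (y z : Syz) : Syz_class y = Syz_class z <-> y - z \in Kosz.
Proof. by rewrite -(quoproj_eq Kosz); split=> /eqP. Qed.

Lemma Syz_classZD (a : S) (y z : Syz) :
  Syz_class (a *: y + z) = prS a *: Syz_class y + Syz_class z.
Proof.
rewrite /Syz_class raddfD /= linearZ; congr (_ + _).
exact/esym/(annscaleE SR_ideal_Syz_Kosz a).
Qed.

Definition Hom_free := homs 'rV[S]_ngens (quomod SR_ideal).
Definition Hom_SyzKosz := homs SyzKosz SR_ring^o.
Identity Coercion Hom_free_homs : Hom_free >-> homs.
Identity Coercion Hom_SyzKosz_homs : Hom_SyzKosz >-> homs.
HB.instance Definition _ := GRing.Lmodule.on Hom_free.
HB.instance Definition _ := GRing.Lmodule.on Hom_SyzKosz.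

Lemma gen_map_ideal f : gen_map f \in SR_ideal.
Proof.
rewrite /gen_map; apply: (big_ind (fun p : S^o => p \in SR_ideal)).
- exact: rpred0.
- by move=> p q; apply: rpredD.
move=> j _; apply: (@rpredZ _ _ SR_ideal); apply: mem_genmod.
exists (gen_support j) => //.
by have := enum_valP j; rewrite inE => /minsetp.
Qed.

Lemma SR_ideal_SR_ring (a : S) (y : quomod SR_ideal) :
  a \in SR_ideal -> a *: y = 0.
Proof.
move=> Ia; have [p ->] := quoproj_surj y.
rewrite -linearZ -(raddf0 (quoproj SR_ideal)); apply/eqP.
rewrite (quoproj_eq SR_ideal) subr0 /GRing.scale /= mulrC.
exact: (@rpredZ _ _ SR_ideal).
Qed.

Lemma Hom_free_Kosz (phi : Hom_free) (z : Syz) : z \in Kosz -> phi (val z) = 0.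
Proof.
move=> /genmodP[k [b [x [Xx ->]]]].
rewrite !raddf_sum big1 // => i _; rewrite /= linearZ /=.
have [f [g /= ->]] := Xx i.
by rewrite raddfB /= !linearZ /= !(SR_ideal_SR_ring _ (gen_map_ideal _)) addr0 scaler0.
Qed.

Lemma SR_ring_scaleE (a : S) (y : quomod SR_ideal) :
  prS a *: (y : SR_ring^o) = a *: y.
Proof.
have [p ->] := quoproj_surj y; rewrite -[RHS]linearZ.
exact: (quomulE SR_ideal a p).
Qed.

Definition restrict_fun (phi : Hom_free) (x : SyzKosz) : SR_ring^o :=
  phi (val (repr (x : quomod Kosz))).

Lemma restrict_funE phi z : restrict_fun phi (Syz_class z) = phi (val z).
Proof.
have /Syz_classP/(Hom_free_Kosz phi) :
    Syz_class (repr (Syz_class z : quomod Kosz)) = Syz_class z.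
  exact: quoproj_repr.
by rewrite raddfB => /subr0_eq.
Qed.

Fact restrict_fun_is_linear phi : linear (restrict_fun phi).
Proof.
move=> c x y; have [a ->] := quoring_proj_surj c.
have [u ->] := Syz_class_surj x; have [v ->] := Syz_class_surj y.
rewrite -Syz_classZD !restrict_funE !raddfD !linearZ /=; congr (_ + _).
by rewrite [LHS]linearZ /= SR_ring_scaleE.
Qed.

Definition restrict (phi : Hom_free) : Hom_SyzKosz :=
  mk_hom (restrict_fun_is_linear phi).

Definition restrict_im : {pred Hom_SyzKosz} :=
  fun psi => `[< exists phi, psi = restrict phi >].

Lemma restrict_imP psi :
  reflect (exists phi, psi = restrict phi) (psi \in restrict_im).
Proof. exact: asboolP. Qed.

Lemma restrictE phi z : restrict phi (Syz_class z) = phi (val z).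
Proof. exact: restrict_funE. Qed.

Fact restrict_im_subsemimod_closed : subsemimod_closed restrict_im.
Proof.
split; first split.
- apply/restrict_imP; exists 0; apply: homs_eqP => x.
  by have [z ->] := Syz_class_surj x; rewrite restrictE.
- move=> _ _ /restrict_imP[f ->] /restrict_imP[g ->].
  apply/restrict_imP; exists (f + g); apply: homs_eqP => x.
  have [z ->] := Syz_class_surj x; rewrite restrictE.
  by rewrite !homsDE (restrictE f) (restrictE g).
move=> c _ /restrict_imP[f ->]; have [a ->] := quoring_proj_surj c.
apply/restrict_imP; exists (a *: f); apply: homs_eqP => x.
have [z ->] := Syz_class_surj x; rewrite restrictE.
by rewrite !homsZE (restrictE f) SR_ring_scaleE.
Qed.
HB.instance Definition _ := GRing.isSubmodClosed.Build SR_ring Hom_SyzKosz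
  restrict_im restrict_im_subsemimod_closed.

(* The cokernel of restrict. *)
Definition T2 := quomod restrict_im.
HB.instance Definition _ := GRing.Lmodule.on T2.

(** * The Z^n-grading *)

Definition mono_deg (m : 'X_{1..n}) : 'rV[int]_n := \row_i (m i)%:Z.
Definition gen_deg (j : 'I_ngens) : 'rV[int]_n :=
  \row_i (i \in gen_support j)%:Z.

Definition homog_S (a : 'rV[int]_n) (p : S) : Prop :=
  forall m, m \in msupp p -> mono_deg m = a.

Lemma sqfree_monomialE (F : {set 'I_n}) :
  sqfree_monomial F = 'X_[[multinom (i \in F : nat) | i < n]].
Proof.
rewrite mpolyXE_id /sqfree_monomial big_mkcond /=.
by apply: eq_bigr => i _; rewrite mnmE; case: (i \in F).
Qed.

Lemma homog_gen (j : 'I_ngens) : homog_S (gen_deg j) (gen j).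
Proof.
move=> m; rewrite /gen sqfree_monomialE msuppX inE => /eqP ->.
by apply/rowP => i; rewrite !mxE mnmE.
Qed.

Definition homog_SR (a : 'rV[int]_n) (t : SR_ring) : Prop :=
  exists2 p, homog_S a p & t = prS p.

(* The j-th basis vector of S^m has degree gen_deg j, so that gen_map is       *)
(* homogeneous of degree 0.                                                   *)
Definition homog_free (a : 'rV[int]_n) (f : 'rV[S]_ngens) : Prop :=
  forall j, homog_S (a - gen_deg j) (f 0 j).
Definition homog_SyzKosz (a : 'rV[int]_n) (x : SyzKosz) : Prop :=
  exists2 z : Syz, homog_free a (val z) & x = Syz_class z.
Definition homog_Hom (c : 'rV[int]_n) (psi : Hom_SyzKosz) : Prop :=
  forall a x, homog_SyzKosz a x -> homog_SR (a + c) (psi x).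

(* T2 is a K-vector space through K -> S -> S/I; its degree c component is     *)
(* the set of classes of homomorphisms of degree c.                           *)
Definition T2_over_K := restr_scalars T2 (prS \o @mpolyC n K).
HB.instance Definition _ := GRing.Lmodule.on T2_over_K.

Definition homog_T2 (c : 'rV[int]_n) : {pred T2_over_K} :=
  fun t => `[< exists2 psi, homog_Hom c psi & t = quoproj restrict_im psi >].

Lemma homog_T2P c t :
  reflect (exists2 psi, homog_Hom c psi & t = quoproj restrict_im psi)
          (t \in homog_T2 c).
Proof. exact: asboolP. Qed.

Lemma homog_SD a p q : homog_S a p -> homog_S a q -> homog_S a (p + q).
Proof.
move=> hp hq m mpq; have := msuppD_le mpq.
by rewrite mem_cat => /orP[/hp|/hq].
Qed.

Lemma homog_SZ a (k : K) p : homog_S a p -> homog_S a (k%:MP * p).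
Proof. by move=> hp m; rewrite mul_mpolyC => /msuppZ_le/hp. Qed.

Fact homog_T2_subsemimod_closed c : subsemimod_closed (homog_T2 c).
Proof.
split; first split.
- apply/homog_T2P; exists 0; last by rewrite raddf0.
  by move=> a x _; exists 0; [move=> m; rewrite msupp0|rewrite raddf0].
- move=> _ _ /homog_T2P[f hf ->] /homog_T2P[g hg ->].
  apply/homog_T2P; exists (f + g); last by rewrite raddfD.
  move=> a x hx; have [p hp fE] := hf a x hx; have [q hq gE] := hg a x hx.
  exists (p + q); first exact: homog_SD.
  by rewrite homsDE fE gE raddfD.
move=> k _ /homog_T2P[f hf ->].
apply/homog_T2P; exists (prS k%:MP *: f); last by rewrite linearZ.
move=> a x hx; have [p hp fE] := hf a x hx.
exists (k%:MP * p); first exact: homog_SZ.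
by rewrite homsZE fE rmorphM.
Qed.
HB.instance Definition _ c := GRing.isSubmodClosed.Build K T2_over_K
  (homog_T2 c) (homog_T2_subsemimod_closed c).

Definition T2_deg (c : 'rV[int]_n) := submodule (homog_T2 c).
HB.instance Definition _ c := GRing.Lmodule.on (T2_deg c).
End SecondCotangent.

(** * Uniform matroids, the full simplex and its boundary *)

Definition uniform_matroid (n r : nat) : {set {set 'I_n}} :=
  [set F : {set 'I_n} | (#|F| <= r)%N].
Definition full_simplex (n : nat) : {set {set 'I_n}} := [set: {set 'I_n}].
Definition simplex_boundary (n : nat) : {set {set 'I_n}} :=
  [set F : {set 'I_n} | F \proper [set: 'I_n]].

Definition zero_one_vector (n : nat) (b : 'rV[int]_n) : Prop :=
  forall i, b 0 i = 0 \/ b 0 i = 1.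
Definition vec_support (n : nat) (b : 'rV[int]_n) : {set 'I_n} :=
  [set i | b 0 i != 0].

(* Main.v *)
(* Every minimal nonface of the uniform matroid has r + 1 elements, and the   *)
(* syzygies are generated by the linear ones x_i e_{U - i} - x_j e_{U - j}    *)
(* with #U = r + 2 (basis exchange). A homomorphism of degree -B, where B is  *)
(* the support of b, maps such a syzygy to a multiple of x^{U - B}, which is  *)
(* zero in S/I unless B is contained in U and #(U - B) <= r; so #B >= 2. It   *)
(* also vanishes when i, j are in B, as x^{U - i - j} times the syzygy is a   *)
(* Koszul relation. Hence the homomorphism amounts to scalars c(U, l) with l  *)
(* in U - B, and it is a restriction from S^m iff c(U, l) depends only on the *)
(* circuit U - l. For #B >= 3 the relation inside U + l' forces this. For     *)
(* #B = 2 there is no constraint on c: the pairs (U - B, l) are the flags     *)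
(* (f, l), l in f, #f = r, of which there are r * C(n-2, r), and those        *)
(* depending only on f - l form a space of dimension C(n-2, r-1).             *)

From HB Require Import structures.
Require Import Defs.
From mathcomp Require Import all_boot all_order all_algebra.
From mathcomp Require Import mpoly.
From mathcomp Require Import boolp.
From mathcomp Require Import zify.

Set Implicit Arguments.
Unset Strict Implicit.
Unset Printing Implicit Defensive.

Import GRing.Theory.
Local Open Scope ring_scope.

(** * Monomials and supports *)

(** In degree -B a homomorphism is pinned down by scalars attached to generating syzygies; the
    theorem counts these scalars modulo those coming from S^m. By [syz_gen_lin_syz] the exchange
    syzygies [lin_syz U i j], #U = r + 2, generate all syzygies, so by [hom_val_ext] it suffices to
    know the values at [lin_Syz U l i0] for one i0 in each U. With i0 taken in B when B lies in U,
    [hom_lin_Syz_homog] and [hom_lin_Syz_Kosz] leave only values c(U, l) x^{U - B} with l in U - B.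

    If #B < 2, then x^{U - B} lies in I. If #B > 2, the relation [lin_Syz_exchange] among r + 3
    elements forces c(U, l) to depend on U - l only, and such a homomorphism is a restriction. Both
    cases are [homog_restrict_im].

    If #B = 2, every choice of scalars occurs: [flag_hom] realizes each flag (f, l) = (U - B, l)
    separately, and by [homog_flag_comb] these homomorphisms span. By [flag_comb_restrict_im] the
    restrictions are the combinations whose coefficients depend only on f - l, that is, those in the
    row space of [ridge_mx]. Its rows are independent, so [has_dim_span] gives the dimension as a
    difference of two counts. [pair_bin_dim] rewrites it as (n - 2 - r) C(n - 2, r - 1), from which
    the vanishing criterion is read off. *)

Section SquarefreeMonomials.
Variable n : nat.
Implicit Types (m u : 'X_{1..n}) (F G P : {set 'I_n}).

Definition mnm_supp m : {set 'I_n} := [set i | m i != 0%N].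
Definition mnm_set F : 'X_{1..n} := [multinom (i \in F : nat) | i < n].

Lemma mnm_suppD m u : mnm_supp (m + u)%MM = mnm_supp m :|: mnm_supp u.
Proof. by apply/setP => i; rewrite !inE mnmDE addn_eq0 negb_and. Qed.

Lemma mnm_supp_set F : mnm_supp (mnm_set F) = F.
Proof. by apply/setP => i; rewrite !inE mnmE; case: (i \in F). Qed.

Lemma mnm_set_le F m : (mnm_set F <= m)%MM = (F \subset mnm_supp m).
Proof.
apply/mnm_lepP/subsetP => [leFm i iF|sFm i].
  by have := leFm i; rewrite mnmE iF inE lt0n.
by rewrite mnmE; case: (boolP (i \in F)) => // /sFm; rewrite inE lt0n.
Qed.

Lemma mnm_setU F G : [disjoint F & G] ->
  mnm_set (F :|: G) = (mnm_set F + mnm_set G)%MM.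
Proof.
move=> FG0; apply/mnmP => i; rewrite mnmDE !mnmE inE.
by case: (boolP (i \in F)) => // iF; rewrite (disjointFr FG0 iF).
Qed.

Lemma mnm_setD1 F i : i \in F -> mnm_set F = (mnm_set (F :\ i) + U_(i))%MM.
Proof.
move=> iF; apply/mnmP => j; rewrite mnmDE !mnmE !inE eq_sym.
by case: (eqVneq i j) => [<-|_]; rewrite ?iF ?addn0.
Qed.

Lemma mono_degD m u : mono_deg (m + u)%MM = mono_deg m + mono_deg u.
Proof. by apply/rowP => i; rewrite !mxE mnmDE PoszD. Qed.

Lemma mono_deg_inj : injective (@mono_deg n).
Proof. by move=> m u /rowP mu; apply/mnmP => i; have := mu i; rewrite !mxE => -[]. Qed.

Lemma mono_deg_set F : mono_deg (mnm_set F) = \row_i (i \in F)%:Z.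
Proof. by apply/rowP => i; rewrite !mxE mnmE. Qed.
End SquarefreeMonomials.

Section MonomialProducts.
Variables (K : fieldType) (n : nat).
Implicit Types (p q : {mpoly K[n]}) (m u : 'X_{1..n}).

Lemma sqfree_monomial_mnm_set (F : {set 'I_n}) :
  sqfree_monomial K F = 'X_[mnm_set F].
Proof. exact: sqfree_monomialE. Qed.

Lemma mem_msuppM p q m : m \in msupp (p * q) ->
  exists m1 m2, [/\ m1 \in msupp p, m2 \in msupp q & m = (m1 + m2)%MM].
Proof. by move=> /msuppM_le/allpairsP[[m1 m2] [? ? ->]]; exists m1, m2. Qed.

Lemma mcoeffMX_le p m u :
  (p * 'X_[m])@_u = if (m <= u)%MM then p@_(u - m) else 0.
Proof.
case: ifPn => [lemu|nlemu]; first by rewrite -{1}(submK lemu) addmC mcoeffMX.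
apply/eqP; rewrite mcoeff_eq0; apply: contra nlemu => /mem_msuppM[m1 [m2 []]].
by rewrite msuppX inE => _ /eqP -> ->; apply: lem_addl.
Qed.

(** Distinct monomials have distinct degrees in the Z^n-grading, so at most one monomial can
    occur. *)
Lemma homog_S_scaleX (a : 'rV[int]_n) p : homog_S a p ->
  p = 0 \/ exists c m, mono_deg m = a /\ p = c *: 'X_[m].
Proof.
move=> pa; case: (eqVneq p 0) => [->|p0]; [by left|right].
have [m mp] : exists m, m \in msupp p.
  have := p0; rewrite -msupp_eq0; case: (msupp p) => // m s _.
  by exists m; rewrite inE eqxx.
exists p@_m, m; split; first exact: pa.
apply/mpolyP => u; rewrite mcoeffZ mcoeffX.
case: (eqVneq m u) => [<-|mu]; first by rewrite mulr1.
rewrite mulr0; apply/eqP; rewrite mcoeff_eq0; apply: contra mu => up.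
by apply/eqP/mono_deg_inj; rewrite (pa _ mp) (pa _ up).
Qed.
End MonomialProducts.

(** * Setting variables to zero *)

Section Substitution.
Variables (K : fieldType) (n : nat) (f : {set 'I_n}).
Implicit Types (p q : {mpoly K[n]}) (m : 'X_{1..n}).

(** The retraction of S onto the polynomials in the variables of [f]. When #f = r, it keeps the part
    of a coefficient that acts nontrivially in S/I on monomials of support [f]. *)
Definition kill_outside p : {mpoly K[n]} :=
  p \mPo [tuple (if i \in f then 'X_i else 0) | i < n].
HB.instance Definition _ := GRing.RMorphism.copy kill_outside
  (comp_mpoly [tuple (if i \in f then 'X_i else 0 : {mpoly K[n]}) | i < n]).

Lemma kill_outsideX m :
  kill_outside 'X_[m] = if mnm_supp m \subset f then 'X_[m] else 0.
Proof.
rewrite /kill_outside comp_mpolyX; case: ifPn => [/subsetP smf|/subsetPn[i im iNf]].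
  rewrite mpolyXE_id; apply: eq_bigr => i _; rewrite tnth_mktuple.
  case: ifPn => // iNf; suff /eqP -> : m i == 0%N by rewrite !expr0.
  by apply: contraNT iNf => mi; apply: smf; rewrite inE.
rewrite (bigD1 i) //= tnth_mktuple (negPf iNf) expr0n.
by move: im; rewrite inE => /negPf ->; rewrite mul0r.
Qed.

Lemma mcoeff_kill_outside p m :
  (kill_outside p)@_m = if mnm_supp m \subset f then p@_m else 0.
Proof.
rewrite {1}(mpolyE p) rmorph_sum raddf_sum /=.
transitivity (\sum_(u <- msupp p)
    (if mnm_supp m \subset f then (p@_u *: 'X_[u])@_m else 0)).
  apply: eq_bigr => u _; rewrite -mul_mpolyC rmorphM /=.
  rewrite {1}/kill_outside comp_mpolyC kill_outsideX !mcoeffCM.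
  rewrite (fun_if (mcoeff m)) mcoeff0 mcoeffX.
  case: (eqVneq u m) => [<-|_]; first by case: ifP; rewrite ?mulr0.
  by rewrite !if_same mulr0 if_same.
case: ifP => _; last by rewrite big1.
by rewrite [in RHS](mpolyE p) raddf_sum.
Qed.

Lemma mem_kill_outside p m : m \in msupp (kill_outside p) ->
  mnm_supp m \subset f /\ m \in msupp p.
Proof.
by rewrite !mcoeff_msupp mcoeff_kill_outside; case: ifP => // _; rewrite eqxx.
Qed.

Lemma mem_sub_kill_outside p m :
  m \in msupp (p - kill_outside p) -> ~~ (mnm_supp m \subset f).
Proof.
rewrite mcoeff_msupp mcoeffB mcoeff_kill_outside; case: ifP => //.
by rewrite subrr eqxx.
Qed.
End Substitution.

(** * The Stanley-Reisner ideal of a uniform matroid *)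

Section UniformIdeal.
Variables (K : fieldType) (n r : nat).
Local Notation Delta := (uniform_matroid n r).
Local Notation S := {mpoly K[n]}.
Local Notation I := (@SR_ideal K n Delta).

Lemma notin_uniform (F : {set 'I_n}) : (F \notin Delta) = (r < #|F|)%N.
Proof. by rewrite inE -ltnNge. Qed.

Lemma min_nonfaces_uniform (P : {set 'I_n}) :
  (P \in min_nonfaces Delta) = (#|P| == r.+1).
Proof.
rewrite inE; apply/minsetP/idP => [[/= PN minP]|/eqP cP]; last first.
  split=> [|Q /= QN sQP]; first by rewrite /= notin_uniform cP.
  by apply/eqP; rewrite eqEcard sQP cP -notin_uniform.
rewrite notin_uniform in PN.
have /card_gt0P[i iP] : (0 < #|P|)%N by apply: leq_trans PN.
have cPi := cardsD1 i P; rewrite iP add1n in cPi.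
have [rlt|] := ltnP r #|P :\ i|; last first.
  by rewrite eqn_leq cPi => le; rewrite ltnS le -cPi.
have PiE : P :\ i = P by apply: minP; rewrite ?subD1set //= notin_uniform.
by rewrite PiE in cPi; lia.
Qed.

Lemma card_gen_support (j : 'I_(ngens Delta)) : #|gen_support j| = r.+1.
Proof. by have := enum_valP j; rewrite min_nonfaces_uniform => /eqP. Qed.

(** The generators have supports of r + 1 elements and multiplication only enlarges supports.
    Together with [mem_SR_ideal], this turns membership in I into a test on each monomial. *)
Lemma SR_ideal_supp (p : S) m :
  p \in I -> m \in msupp p -> (r < #|mnm_supp m|)%N.
Proof.
move=> /SR_ideal_gen[f ->]; rewrite /gen_map => /msupp_sum_le.
rewrite filter_predT => /flattenP[s /mapP[j _ ->]] /mem_msuppM[m1 [m2 [_ m2g ->]]].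
rewrite -(card_gen_support j); apply: subset_leq_card; rewrite mnm_suppD.
move: m2g; rewrite /gen sqfree_monomial_mnm_set msuppX inE => /eqP ->.
by rewrite mnm_supp_set subsetUr.
Qed.

Lemma mem_SR_ideal (p : S) :
  (forall m, m \in msupp p -> (r < #|mnm_supp m|)%N) -> p \in I.
Proof.
move=> bigm; rewrite [p]mpolyE big_seq.
apply: (@rpred_sum _ I) => m /bigm rm.
have -> : p@_m *: 'X_[m] = (p@_m *: 'X_[m - mnm_set (mnm_supp m)] : S) *:
    (sqfree_monomial K (mnm_supp m) : S^o).
  rewrite [RHS]/GRing.scale /= sqfree_monomial_mnm_set -scalerAl -mpolyXD.
  by rewrite submK // mnm_set_le.
apply: (@rpredZ _ _ I); apply: mem_genmod.
by exists (mnm_supp m); rewrite ?notin_uniform.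
Qed.

Lemma mcoeff_SR_ideal (p : S) m :
  p \in I -> (#|mnm_supp m| <= r)%N -> p@_m = 0.
Proof.
move=> pI mr; apply/eqP; rewrite mcoeff_eq0; apply/negP => /(SR_ideal_supp pI).
by rewrite ltnNge mr.
Qed.

Definition SR_class (p : S) : SR_ring K Delta := quoring_proj I p.
HB.instance Definition _ := GRing.RMorphism.copy SR_class (quoring_proj I).

Lemma SR_class_eq0 (p : S) : SR_class p = 0 <-> p \in I.
Proof. by rewrite -(quoproj_eq0 I); split=> [/eqP|/eqP]. Qed.

(** The coefficient is read on a chosen representative; by [SR_coeffE] the choice is immaterial when
    the support of [u] has at most r elements. *)
Definition SR_coeff (u : 'X_{1..n}) (t : SR_ring K Delta) : K :=
  (repr (t : quomod I) : S)@_u.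

Lemma SR_coeffE u (p : S) : (#|mnm_supp u| <= r)%N -> SR_coeff u (SR_class p) = p@_u.
Proof.
move=> ur; apply/eqP; rewrite -subr_eq0 -mcoeffB; apply/eqP.
apply: mcoeff_SR_ideal => //; rewrite -(quoproj_eq I).
by rewrite quoproj_repr.
Qed.
End UniformIdeal.

(** * The free module on the circuits *)

Section FreeModule.
Variables (K : fieldType) (n r : nat).
Local Notation Delta := (uniform_matroid n r).
Local Notation S := {mpoly K[n]}.
Local Notation Sm := 'rV[S]_(ngens Delta).
Implicit Types (P Q U : {set 'I_n}) (v w : Sm).

(** Basis vectors and coordinates are indexed by sets instead of positions in the enumeration of
    circuits; both are zero for a set that is not a circuit. *)
Definition gen_vec P : Sm := \row_j (gen_support j == P)%:R.
Definition coord P v : S := \sum_(j | gen_support j == P) v 0 j.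

Lemma coordZD P a v w : coord P (a *: v + w) = a * coord P v + coord P w.
Proof.
rewrite /coord mulr_sumr -big_split; apply: eq_bigr => j _.
by rewrite !mxE.
Qed.

Lemma coordB P v w : coord P (v - w) = coord P v - coord P w.
Proof. by rewrite addrC -scaleN1r coordZD mulN1r addrC. Qed.

Lemma coordZ P a v : coord P (a *: v) = a * coord P v.
Proof.
by rewrite /coord mulr_sumr; apply: eq_bigr => j _; rewrite !mxE.
Qed.

Lemma gen_support_inj : injective (@gen_support n Delta).
Proof. exact: enum_val_inj. Qed.

Lemma gen_support_surj P : #|P| = r.+1 -> exists j, @gen_support n Delta j = P.
Proof.
move=> /eqP; rewrite -min_nonfaces_uniform => Pmin.
by exists (enum_rank_in Pmin P); apply: enum_rankK_in.
Qed.

Lemma coord_gen_support j v : coord (gen_support j) v = v 0 j.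
Proof. by apply: big_pred1 => k /=; apply: (inj_eq gen_support_inj). Qed.

Lemma coord_gen_vec P Q : #|P| = r.+1 -> coord P (gen_vec Q) = (P == Q)%:R.
Proof. by case/gen_support_surj => j <-; rewrite coord_gen_support mxE. Qed.

Lemma gen_mapE v : gen_map v = \sum_j v 0 j * 'X_[mnm_set (gen_support j)].
Proof. by apply: eq_bigr => j _; rewrite /gen sqfree_monomial_mnm_set. Qed.

(* The values are restated in S, since they are typed in S^o by linearity.     *)
Lemma gen_mapB v w : gen_map (v - w) = gen_map v - gen_map w :> S.
Proof. exact: (raddfB (@gen_map K n Delta)). Qed.

Lemma gen_mapZS a v : gen_map (a *: v) = a * gen_map v :> S.
Proof. exact: gen_mapZ. Qed.

Lemma gen_map_gen_vec P : #|P| = r.+1 -> gen_map (gen_vec P) = 'X_[mnm_set P].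
Proof.
case/gen_support_surj => j <-; rewrite gen_mapE (bigD1 j) //= mxE eqxx mul1r.
rewrite big1 ?addr0 // => k kj.
by rewrite mxE (inj_eq gen_support_inj) (negPf kj) mul0r.
Qed.

Lemma gen_vec_sum v : v = \sum_j v 0 j *: gen_vec (gen_support j).
Proof.
apply/rowP => k; rewrite summxE (bigD1 k) //= !mxE eqxx mulr1.
rewrite big1 ?addr0 // => j jk.
by rewrite !mxE (inj_eq gen_support_inj) eq_sym (negPf jk) mulr0.
Qed.
End FreeModule.

(** * Generation of the syzygies *)

Section LinearSyzygies.
Variables (K : fieldType) (n r : nat).
Local Notation Delta := (uniform_matroid n r).
Local Notation S := {mpoly K[n]}.
Local Notation Sm := 'rV[S]_(ngens Delta).
Implicit Types (P Q U : {set 'I_n}) (v w : Sm) (m u : 'X_{1..n}).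

Definition lin_syz U i j : Sm :=
  'X_i *: gen_vec K r (U :\ i) - 'X_j *: gen_vec K r (U :\ j).

Lemma card_circuitD1 U i : #|U| = r.+2 -> i \in U -> #|U :\ i| = r.+1.
Proof. by move=> cU iU; have := cardsD1 i U; rewrite cU iU add1n => -[]. Qed.

Lemma coord_lin_syz P U i j : #|P| = r.+1 ->
  coord P (lin_syz U i j) =
  (P == U :\ i)%:R * 'X_i - (P == U :\ j)%:R * 'X_j.
Proof.
by move=> cP; rewrite coordB !coordZ !coord_gen_vec // mulrC ['X_j * _]mulrC.
Qed.

Lemma gen_map_lin_syz U i j : #|U| = r.+2 -> i \in U -> j \in U ->
  gen_map (lin_syz U i j) = 0.
Proof.
move=> cU iU jU; rewrite gen_mapB !gen_mapZS !gen_map_gen_vec ?card_circuitD1 //.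
have XE k : k \in U -> 'X_k * 'X_[mnm_set (U :\ k)] = 'X_[mnm_set U] :> S.
  by move=> kU; rewrite mulrC -mpolyXD -mnm_setD1.
by rewrite !XE // subrr.
Qed.

Definition is_lin_syz v := exists U i j,
  [/\ #|U| = r.+2, i \in U, j \in U & v = lin_syz U i j].
Local Notation N := (genmod is_lin_syz).

(** Basis exchange by induction on #(P - Q): trading p in P - Q for q in Q - P changes the vector by
    a multiple of a linear syzygy inside q |: P, which still lies in the support of u. *)
Lemma exchange_lin_syz u P Q : #|P| = r.+1 -> #|Q| = r.+1 ->
    P \subset mnm_supp u -> Q \subset mnm_supp u ->
  ('X_[u - mnm_set P] : S) *: gen_vec K r P
    - ('X_[u - mnm_set Q] : S) *: gen_vec K r Q \in N.
Proof.
move=> cP cQ + sQu; have [k] := ubnP #|P :\: Q|.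
elim: k => // k IHk in P cP * => ltPQk sPu.
have [|/set0Pn[p]] := eqVneq (P :\: Q) set0.
  move/eqP; rewrite setD_eq0 => sPQ.
  have /eqP -> : P == Q by rewrite eqEcard sPQ cP cQ /=.
  by rewrite subrr; apply: (rpred0 N).
rewrite inE => /andP[pNQ pP].
have /set0Pn[q] : Q :\: P != set0.
  rewrite setD_eq0; apply: contra pNQ => sQP.
  by have /eqP -> : Q == P by rewrite eqEcard sQP cP cQ /=.
rewrite inE => /andP[qNP qQ].
pose U := q |: P; have cU : #|U| = r.+2 by rewrite cardsU1 qNP cP.
have qU : q \in U by rewrite !inE eqxx.
have pU : p \in U by rewrite !inE pP orbT.
have UqE : U :\ q = P by rewrite setU1K.
have cP' := card_circuitD1 cU pU.
have sUu : U \subset mnm_supp u by rewrite subUset sub1set (subsetP sQu).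
have subU i : i \in U ->
    'X_[u - mnm_set (U :\ i)] = 'X_[u - mnm_set U] * 'X_i :> S.
  move=> iU; rewrite -mpolyXD; congr 'X_[_].
  apply/(@addIm _ (mnm_set (U :\ i))).
  rewrite submK ?mnm_set_le ?(subset_trans (subD1set _ _)) // -addmA.
  by rewrite [(U_(i) + _)%MM]addmC -mnm_setD1 // submK // mnm_set_le.
have step : ('X_[u - mnm_set P] : S) *: gen_vec K r P
    - ('X_[u - mnm_set (U :\ p)] : S) *: gen_vec K r (U :\ p) \in N.
  rewrite -{1 2}UqE !subU // -!scalerA -scalerBr.
  by apply: (@rpredZ _ _ N); apply: mem_genmod; exists U, q, p.
have sPu' := subset_trans (subD1set U p) sUu.
have tail := IHk (U :\ p) cP'.
have -> : ('X_[u - mnm_set P] : S) *: gen_vec K r P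
    - ('X_[u - mnm_set Q] : S) *: gen_vec K r Q
  = (('X_[u - mnm_set P] : S) *: gen_vec K r P
      - ('X_[u - mnm_set (U :\ p)] : S) *: gen_vec K r (U :\ p))
    + (('X_[u - mnm_set (U :\ p)] : S) *: gen_vec K r (U :\ p)
      - ('X_[u - mnm_set Q] : S) *: gen_vec K r Q).
  by rewrite addrA subrK.
apply: (@rpredD _ N _ _ step); apply: tail sPu'.
have cD : #|P :\: Q| = #|(U :\ p) :\: Q|.+1.
  rewrite (cardsD1 p) inE pNQ pP; congr _.+1; apply: eq_card => x.
  rewrite !inE; case: (eqVneq x q) => [->|_]; first by rewrite qQ !andbF.
  by rewrite /= andbCA.
by rewrite -ltnS -cD.
Qed.

(* A vector is normal when each of its monomials x^m e_j sits on the circuit  *)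
(* chosen by [pick] among those dividing its degree.                          *)
Definition normal v := forall j m, m \in msupp (v 0 j) ->
  [pick k | mnm_set (@gen_support n Delta k) <= m + mnm_set (gen_support j)]%MM
    = Some j.

Lemma normal0 : normal 0.
Proof. by move=> j m; rewrite mxE msupp0. Qed.

Lemma normalD v w : normal v -> normal w -> normal (v + w).
Proof.
move=> nv nw j m; rewrite mxE => /msuppD_le; rewrite mem_cat.
by case/orP => [/nv|/nw].
Qed.

Lemma normalZ (c : K) v : normal v -> normal (c%:MP *: v).
Proof. by move=> nv j m; rewrite mxE mul_mpolyC => /msuppZ_le/nv. Qed.

(** By additivity one term c x^m e_j is enough, and [exchange_lin_syz] moves it to the chosen
    circuit dividing the same degree. *)
Lemma exists_normal v : exists2 w, normal w & v - w \in N.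
Proof.
rewrite (gen_vec_sum v).
apply: (big_ind (fun v => exists2 w, normal w & v - w \in N)).
- by exists 0; [exact: normal0 | rewrite subrr; exact: (rpred0 N)].
- move=> x y [wx nx xN] [wy ny yN]; exists (wx + wy); first exact: normalD.
  by rewrite opprD addrACA; exact: (@rpredD _ N _ _ xN yN).
move=> j _; rewrite {1}[v 0 j]mpolyE scaler_suml.
apply: (big_ind (fun v => exists2 w, normal w & v - w \in N)).
- by exists 0; [exact: normal0 | rewrite subrr; exact: (rpred0 N)].
- move=> x y [wx nx xN] [wy ny yN]; exists (wx + wy); first exact: normalD.
  by rewrite opprD addrACA; exact: (@rpredD _ N _ _ xN yN).
move=> m _; set c := _@_m; pose u := (m + mnm_set (gen_support j))%MM.
have [k|noj] := pickP (fun k =>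
    mnm_set (@gen_support n Delta k) <= u)%MM; last first.
  by have := noj j; rewrite /= lem_addl.
move=> leku.
have [l pl|nok] := pickP (fun k => mnm_set (@gen_support n Delta k) <= u)%MM;
  last by have := nok k; rewrite /= leku.
(* The same [pick] expression as in [normal], unwrapped; the default [l] is never returned since the
   pick succeeds. *)
pose l0 := odflt l [pick k | mnm_set (@gen_support n Delta k) <= u]%MM.
have l0E : [pick k | mnm_set (@gen_support n Delta k) <= u]%MM = Some l0.
  by rewrite /l0; case: pickP => [x _|/(_ l)] //=; rewrite pl.
have lel0 : (mnm_set (@gen_support n Delta l0) <= u)%MM.
  by move: l0E; case: pickP => // x lex [<-].
exists (c%:MP *: (('X_[u - mnm_set (gen_support l0)] : S) *:
  gen_vec K r (gen_support l0))).
  apply: normalZ => k' m'; rewrite !mxE (inj_eq (@gen_support_inj n r)).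
  case: (eqVneq l0 k') => [<-|_]; last by rewrite mulr0 msupp0.
  by rewrite mulr1 msuppX inE => /eqP ->; rewrite submK.
rewrite -mul_mpolyC -scalerA -scalerBr; apply: (@rpredZ _ _ N).
have {1}-> : m = (u - mnm_set (gen_support j))%MM by rewrite addmK.
by apply: exchange_lin_syz; rewrite ?card_gen_support -?mnm_set_le ?lem_addl.
Qed.

(** In each degree u only the chosen circuit can carry a term, so nothing cancels in [gen_map v]:
    its coefficient at u is a single coefficient of v. *)
Lemma normal_gen_map_eq0 v : normal v -> gen_map v = 0 -> v = 0.
Proof.
move=> nv v0; apply/rowP => j; rewrite mxE.
apply/mpolyP => m; rewrite mcoeff0; apply/eqP; rewrite mcoeff_eq0.
apply/negP => mv; pose u := (m + mnm_set (gen_support j))%MM.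
have := congr1 (mcoeff u) v0; rewrite gen_mapE raddf_sum /= mcoeff0.
rewrite (bigD1 j) //= big1 => [|k kj]; last first.
  rewrite mcoeffMX_le; case: ifP => // leku; apply/eqP; rewrite mcoeff_eq0.
  apply/negP => /nv; rewrite submK // (nv _ _ mv) => -[jk].
  by rewrite jk eqxx in kj.
rewrite addr0 mcoeffMX_le lem_addl /u addmK => /eqP.
by rewrite mcoeff_eq0 mv.
Qed.

(** The normal form of a syzygy is again a syzygy, hence zero. *)
Lemma syz_gen_lin_syz v : gen_map v = 0 -> v \in N.
Proof.
have lin_syz0 w : w \in N -> gen_map w = 0.
  move=> /genmodP[k [a [x [Xx ->]]]]; rewrite raddf_sum big1 // => i _.
  have [U [p [q [cU pU qU ->]]]] := Xx i.
  by rewrite /= linearZ /= gen_map_lin_syz // scaler0.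
have [w nw vwN v0] := exists_normal v.
suff w0 : w = 0 by rewrite w0 subr0 in vwN.
apply: normal_gen_map_eq0 => //.
have := lin_syz0 _ vwN; rewrite gen_mapB v0 sub0r => /eqP.
by rewrite oppr_eq0 => /eqP.
Qed.
End LinearSyzygies.

(** * Homomorphisms on linear syzygies *)

Section HomValues.
Variables (K : fieldType) (n r : nat).
Local Notation Delta := (uniform_matroid n r).
Local Notation S := {mpoly K[n]}.
Local Notation SyzU := (Syz K Delta).
Local Notation HomU := (Hom_SyzKosz K Delta).
Local Notation cls := (@SR_class K n r).
Implicit Types (psi : HomU) (z y : SyzU) (P U : {set 'I_n}) (a : S).

Definition hom_val psi z : SR_ring K Delta := psi (Syz_class z).

Lemma hom_valZD psi a y z :
  hom_val psi (a *: y + z) = cls a * hom_val psi y + hom_val psi z.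
Proof. by rewrite /hom_val Syz_classZD; exact: hom_fun_is_linear psi _ _ _. Qed.

Lemma hom_val0 psi : hom_val psi 0 = 0.
Proof.
have := hom_valZD psi 1 0 0; rewrite scaler0 addr0 (rmorph1 cls) mul1r.
by rewrite -{1}[hom_val psi 0]addr0 => /addrI <-.
Qed.

Lemma hom_valZ psi a z : hom_val psi (a *: z) = cls a * hom_val psi z.
Proof. by rewrite -[a *: z]addr0 hom_valZD hom_val0 addr0. Qed.

Lemma hom_valD psi y z : hom_val psi (y + z) = hom_val psi y + hom_val psi z.
Proof. by rewrite -[y]scale1r hom_valZD (rmorph1 cls) mul1r scale1r. Qed.

Lemma hom_val_sum psi k (a : 'I_k -> S) (y : 'I_k -> SyzU) :
  hom_val psi (\sum_i a i *: y i) = \sum_i cls (a i) * hom_val psi (y i).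
Proof.
by elim/big_rec2: _ => [|i _ z _ <-]; [exact: hom_val0 | exact: hom_valZD].
Qed.

Lemma hom_val_Kosz psi z : z \in @Kosz K n Delta -> hom_val psi z = 0.
Proof.
move=> zK; rewrite -(hom_val0 psi) /hom_val; congr (psi _).
by apply/Syz_classP; rewrite subr0.
Qed.

Lemma val_Syz_inj y z : val y = val z -> y = z.
Proof. exact: val_inj. Qed.

Lemma val_SyzD y z : val (y + z) = val y + val z.
Proof. exact: submoduleDE. Qed.

Lemma val_SyzZ a z : val (a *: z) = a *: val z.
Proof. exact: submoduleZE. Qed.

Lemma val_Syz_sum k (y : 'I_k -> SyzU) : val (\sum_i y i) = \sum_i val (y i).
Proof. by elim/big_rec2: _ => [|i v z _ <-]; [exact: erefl | exact: val_SyzD]. Qed.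

(* Opaque, since unifying two explicit syzygies by unfolding diverges.        *)
Fact lin_Syz_subproof U i j : {z : SyzU |
  #|U| = r.+2 -> i \in U -> j \in U -> val z = lin_syz K r U i j}.
Proof.
exists (insubd (0 : SyzU) (lin_syz K r U i j)) => cU iU jU.
by apply: insubdK; apply/Syz_predP/gen_map_lin_syz.
Qed.

Definition lin_Syz U i j : SyzU := sval (lin_Syz_subproof U i j).

Lemma val_lin_Syz U i j : #|U| = r.+2 -> i \in U -> j \in U ->
  val (lin_Syz U i j) = lin_syz K r U i j.
Proof. exact: (svalP (lin_Syz_subproof U i j)). Qed.

(** Within one U, the syzygy for i, j is the difference of those for i, i0 and j, i0. Letting i0
    depend on U allows it to be taken in B later. *)
Lemma hom_val_ext psi psi' :
  (forall U, #|U| = r.+2 -> exists2 i0, i0 \in U &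
     forall l, l \in U -> l != i0 ->
       hom_val psi (lin_Syz U l i0) = hom_val psi' (lin_Syz U l i0)) ->
  psi = psi'.
Proof.
move=> eqlin; apply: homs_eqP => x; have [z ->] := Syz_class_surj x.
rewrite -/(hom_val psi z) -/(hom_val psi' z).
have /Syz_predP/syz_gen_lin_syz/genmodP[k [a [v [vlin zE]]]] := valP z.
have eqpair U i j : #|U| = r.+2 -> i \in U -> j \in U ->
    hom_val psi (lin_Syz U i j) = hom_val psi' (lin_Syz U i j).
  move=> cU iU jU; have [i0 i0U eqi0] := eqlin U cU.
  have eqi l : l \in U ->
      hom_val psi (lin_Syz U l i0) = hom_val psi' (lin_Syz U l i0).
    case: (eqVneq l i0) => [-> _|li0 lU]; last exact: eqi0.
    suff -> : lin_Syz U i0 i0 = 0 by rewrite !hom_val0.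
    by apply: val_Syz_inj; rewrite (val_lin_Syz cU i0U i0U) /lin_syz subrr.
  have -> : lin_Syz U i j = (-1) *: lin_Syz U j i0 + lin_Syz U i i0.
    apply: val_Syz_inj; rewrite val_SyzD val_SyzZ scaleN1r.
    rewrite (val_lin_Syz cU jU i0U) (val_lin_Syz cU iU i0U) (val_lin_Syz cU iU jU).
    by rewrite /lin_syz opprB [RHS]addrC addrA subrK.
  by rewrite !hom_valZD !eqi.
have /choice[y yP] : forall i, exists y, val y = v i /\
    hom_val psi y = hom_val psi' y.
  move=> i; have [U [p [q [cU pU qU ->]]]] := vlin i.
  by exists (lin_Syz U p q); rewrite (val_lin_Syz cU pU qU) (eqpair _ _ _ cU pU qU).
have -> : z = \sum_i a i *: y i.
  apply: val_Syz_inj; rewrite zE val_Syz_sum; apply: eq_bigr => i _.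
  by rewrite val_SyzZ; have [-> _] := yP i.
rewrite !hom_val_sum; apply: eq_bigr => i _.
by have [_ ->] := yP i.
Qed.
End HomValues.

(** * Constraints from the degree and from the Koszul relations *)

Section HomogeneousHoms.
Variables (K : fieldType) (n r : nat).
Local Notation Delta := (uniform_matroid n r).
Local Notation S := {mpoly K[n]}.
Local Notation SyzU := (Syz K Delta).
Local Notation HomU := (Hom_SyzKosz K Delta).
Local Notation cls := (@SR_class K n r).
Implicit Types (psi : HomU) (z y : SyzU) (B P U : {set 'I_n}) (a : S).

Lemma gen_degE (j : 'I_(ngens Delta)) :
  gen_deg j = mono_deg (mnm_set (gen_support j)).
Proof. by rewrite mono_deg_set. Qed.

Lemma homog_lin_syz U i j : i \in U -> j \in U ->
  homog_free (mono_deg (mnm_set U)) (lin_syz K r U i j).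
Proof.
have homX P k : k \in U -> homog_S
    (mono_deg (mnm_set U) - mono_deg (mnm_set P)) ((P == U :\ k)%:R * 'X_k : S).
  move=> kU m; case: eqVneq => [->|_]; last by rewrite mul0r msupp0.
  rewrite mul1r msuppX inE => /eqP ->; rewrite (mnm_setD1 kU) mono_degD.
  by rewrite addrC addKr.
move=> iU jU k; rewrite -coord_gen_support coord_lin_syz ?card_gen_support //.
rewrite gen_degE => m /msuppB_le; rewrite mem_cat.
by case/orP; apply: homX.
Qed.

(** The value has degree 1_U - 1_B. A negative entry makes it zero, and a monomial x^{U - B} with
    more than r variables is zero in S/I; otherwise a scalar remains, recovered by [SR_coeff]. *)
Lemma hom_lin_Syz_homog B psi U i j : #|U| = r.+2 -> i \in U -> j \in U ->
  homog_Hom (- mono_deg (mnm_set B)) psi ->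
  [/\ ~~ (B \subset U) -> hom_val psi (lin_Syz K r U i j) = 0,
      (r < #|U :\: B|)%N -> hom_val psi (lin_Syz K r U i j) = 0
    & B \subset U -> (#|U :\: B| <= r)%N ->
      hom_val psi (lin_Syz K r U i j) =
        cls (SR_coeff (mnm_set (U :\: B)) (hom_val psi (lin_Syz K r U i j))
             *: 'X_[mnm_set (U :\: B)])].
Proof.
move=> cU iU jU hpsi.
have [|p hp] := hpsi (mono_deg (mnm_set U)) (Syz_class (lin_Syz K r U i j)).
  exists (lin_Syz K r U i j) => //.
  by rewrite (val_lin_Syz K cU iU jU); apply: homog_lin_syz.
rewrite -/(hom_val _ _) -/(cls p) => ->.
have [->|[c [m [dm ->]]]] := homog_S_scaleX hp.
  rewrite (rmorph0 cls); split=> // _ Ur.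
  by rewrite -(rmorph0 cls) SR_coeffE ?mnm_supp_set // mcoeff0 scale0r.
have sBU : B \subset U.
  apply/subsetP => k kB; apply: contraT => kNU.
  have /rowP/(_ k) := dm; rewrite !mxE !mnmE kB (negPf kNU).
  by lia.
have mE : m = mnm_set (U :\: B).
  apply: mono_deg_inj; rewrite dm; apply/rowP => k; rewrite !mxE !mnmE inE.
  have := subsetP sBU k; case: (k \in B) => [->|_] //; case: (k \in U) => //.
split; first by rewrite sBU.
  move=> rU; apply/SR_class_eq0/mem_SR_ideal => u.
  by move=> /msuppZ_le; rewrite msuppX inE => /eqP ->; rewrite mE mnm_supp_set.
move=> _ Ur; rewrite SR_coeffE ?mnm_supp_set // -mE.
by rewrite mcoeffZ mcoeffX eqxx mulr1.
Qed.

Lemma hom_lin_Syz_notsub B psi U i j : #|U| = r.+2 -> i \in U -> j \in U ->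
  homog_Hom (- mono_deg (mnm_set B)) psi -> ~~ (B \subset U) ->
  hom_val psi (lin_Syz K r U i j) = 0.
Proof. by move=> cU iU jU /(hom_lin_Syz_homog cU iU jU)[]. Qed.

(** The Koszul relation of the basis vectors at U - j and U - i has coefficients x^{U - j} and x^{U
    - i}, which share the factor x^{U - i - j}. *)
Lemma Kosz_lin_Syz U i j : #|U| = r.+2 -> i \in U -> j \in U -> i != j ->
  ('X_[mnm_set (U :\ i :\ j)] : S) *: lin_Syz K r U i j \in @Kosz K n Delta.
Proof.
move=> cU iU jU ij; apply: mem_genmod.
have EX k l : k \in U -> l != k ->
    'X_[mnm_set (U :\ l)] = 'X_[mnm_set (U :\ l :\ k)] * 'X_k :> S.
  by move=> kU lk; rewrite -mpolyXD -mnm_setD1 // !inE eq_sym lk.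
have Ui := EX j i jU ij; have Uj := EX i j iU; rewrite eq_sym in Uj.
have UC : U :\ j :\ i = U :\ i :\ j by apply/setP => k; rewrite !inE andbCA.
exists (gen_vec K r (U :\ j)), (gen_vec K r (U :\ i)).
rewrite val_SyzZ (val_lin_Syz K cU iU jU).
rewrite !gen_map_gen_vec; [|exact: card_circuitD1 | exact: card_circuitD1].
by rewrite Ui (Uj ij) UC /lin_syz scalerBr !scalerA.
Qed.

(** With V = U - i - j, the product of x^V and the value is zero by [Kosz_lin_Syz]. As i and j are
    in B, U - B lies in V, so this product is c times a monomial whose support V has r elements;
    such a monomial is nonzero in S/I, and c = 0. *)
Lemma hom_lin_Syz_Kosz B psi U i j : #|U| = r.+2 -> i \in U -> j \in U ->
  i != j -> i \in B -> j \in B -> homog_Hom (- mono_deg (mnm_set B)) psi ->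
  hom_val psi (lin_Syz K r U i j) = 0.
Proof.
move=> cU iU jU ij iB jB hpsi.
have [psi0 _ psiE] := hom_lin_Syz_homog cU iU jU hpsi.
have [sBU|/psi0 //] := boolP (B \subset U).
have cV : #|U :\ i :\ j| = r.
  have := cardsD1 j (U :\ i); rewrite (card_circuitD1 cU iU) !inE eq_sym ij jU.
  by case.
have sV : U :\: B \subset U :\ i :\ j.
  apply/subsetP => k; rewrite !inE => /andP[kNB kU]; rewrite kU andbT.
  by apply/andP; split; apply: contraNneq kNB => ->.
have Ur : (#|U :\: B| <= r)%N by rewrite -[leqRHS]cV subset_leq_card.
have := hom_val_Kosz psi (Kosz_lin_Syz cU iU jU ij).
rewrite hom_valZ (psiE sBU Ur); set c := SR_coeff _ _.
rewrite -rmorphM => /(congr1 (SR_coeff (mnm_set (U :\ i :\ j)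
  + mnm_set (U :\: B))%MM)).
rewrite -(rmorph0 cls) !SR_coeffE ?mnm_suppD ?mnm_supp_set; first last.
- by rewrite (setUidPl sV) cV.
- by rewrite (setUidPl sV) cV.
rewrite mcoeff0 -scalerAr -mpolyXD mcoeffZ mcoeffX eqxx mulr1 => ->.
by rewrite scale0r.
Qed.
End HomogeneousHoms.

(** * Restrictions of functionals on the free module *)

Section RestrictedHoms.
Variables (K : fieldType) (n r : nat).
Local Notation Delta := (uniform_matroid n r).
Local Notation S := {mpoly K[n]}.
Local Notation Sm := 'rV[S]_(ngens Delta).
Local Notation SyzU := (Syz K Delta).
Local Notation HomU := (Hom_SyzKosz K Delta).
Local Notation I := (@SR_ideal K n Delta).
Local Notation cls := (@SR_class K n r).
Implicit Types (psi : HomU) (z y : SyzU) (B P U : {set 'I_n}) (a : S).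

Section FreeHom.
Variable w : {set 'I_n} -> S.

Definition free_form (v : Sm) : S := \sum_j w (gen_support j) * v 0 j.

Lemma free_formZD a v v' : free_form (a *: v + v') = a * free_form v + free_form v'.
Proof.
rewrite /free_form mulr_sumr -big_split; apply: eq_bigr => j _.
by rewrite !mxE /= mulrDr mulrCA.
Qed.

Lemma free_form_gen_vec P : #|P| = r.+1 -> free_form (gen_vec K r P) = w P.
Proof.
case/gen_support_surj => j <-; rewrite /free_form (bigD1 j) //= mxE eqxx mulr1.
rewrite big1 ?addr0 // => k kj.
by rewrite mxE (inj_eq (@gen_support_inj n r)) (negPf kj) mulr0.
Qed.

Lemma free_form_lin_syz U i j : #|U| = r.+2 -> i \in U -> j \in U ->
  free_form (lin_syz K r U i j) = w (U :\ i) * 'X_i - w (U :\ j) * 'X_j.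
Proof.
have formZ k : #|U| = r.+2 -> k \in U -> 'X_k * w (U :\ k) =
    free_form (('X_k : S) *: gen_vec K r (U :\ k)).
  move=> cU kU; rewrite -[_ *: _]addr0 free_formZD free_form_gen_vec.
    by rewrite /free_form big1 ?addr0 // => l _; rewrite mxE mulr0.
  exact: card_circuitD1.
move=> cU iU jU; rewrite /lin_syz addrC -scaleN1r free_formZD -!formZ //.
by rewrite mulN1r addrC ![_ * 'X__]mulrC.
Qed.

Fact free_hom_linear : linear (fun v : Sm => quoproj I (free_form v : S^o)).
Proof.
move=> a v v'; rewrite free_formZD raddfD /=; congr (_ + _).
exact: (@quoproj_is_scalable S S^o I a (free_form v)).
Qed.

Definition free_hom : Hom_free K Delta := mk_hom free_hom_linear.

Lemma hom_val_free_hom z :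
  hom_val (Defs.restrict free_hom) z = cls (free_form (val z)).
Proof. exact: restrictE. Qed.
End FreeHom.

(** The form that degree -B imposes on the image of e_P under a functional on S^m. *)
Definition weight B (mu : {set 'I_n} -> K) P : S :=
  if B \subset P then mu P *: 'X_[mnm_set (P :\: B)] else 0.

(** Since i is in B, the circuit U - i does not contain B and only e_{U - l} contributes. The scalar
    of such a restriction thus depends on U - l alone. *)
Lemma hom_val_weight B mu U l i : #|U| = r.+2 -> l \in U -> i \in U -> i \in B ->
  hom_val (Defs.restrict (free_hom (weight B mu))) (lin_Syz K r U l i) =
  if (B \subset U) && (l \notin B)
  then cls (mu (U :\ l) *: 'X_[mnm_set (U :\: B)]) else 0.
Proof.
move=> cU lU iU iB; rewrite hom_val_free_hom (val_lin_Syz K cU lU iU).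
rewrite free_form_lin_syz // /weight !subsetD1 iB andbF mul0r subr0.
case: ifP => [/andP[sBU lNB]|_]; last by rewrite mul0r; exact: (rmorph0 cls).
rewrite -scalerAl -mpolyXD; congr (cls (_ *: 'X_[_])).
have lUB : l \in U :\: B by rewrite inE lNB.
rewrite (mnm_setD1 lUB); congr (mnm_set _ + _)%MM.
by apply/setP => k; rewrite !inE andbCA.
Qed.
End RestrictedHoms.

(** * Supports of size different from two *)

Section Vanishing.
Variables (K : fieldType) (n r : nat).
Local Notation Delta := (uniform_matroid n r).
Local Notation S := {mpoly K[n]}.
Local Notation HomU := (Hom_SyzKosz K Delta).
Local Notation cls := (@SR_class K n r).
Implicit Types (psi : HomU) (B P U : {set 'I_n}).

Lemma scale_exchange (R : comPzRingType) (M : lmodType R) (x x' y : R) (p q q' : M) :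
  x' *: (x *: p - y *: q) - x *: (x' *: p - y *: q')
    = y *: (x *: q' - x' *: q).
Proof.
rewrite !scalerBr !scalerA [x' * x]mulrC [x' * y]mulrC [x * y]mulrC.
by rewrite opprB [LHS]addrC addrA subrK.
Qed.

(** A relation between linear syzygies inside the (r + 3)-set l' |: U, in which the terms at the
    circuit avoiding l and i cancel. The first summand lives on a set without i, so a homomorphism
    of degree -B with i in B kills it. *)
Lemma lin_Syz_exchange U l l' i : #|U| = r.+2 -> l \in U -> i \in U ->
    l' \notin U -> l != i ->
  ('X_l' : S) *: lin_Syz K r U l i
    = ('X_i : S) *: lin_Syz K r ((l' |: U) :\ i) l l'
      + ('X_l : S) *: lin_Syz K r (l' |: (U :\ l)) l' i.
Proof.
move=> cU lU iU l'NU li; apply: val_Syz_inj; rewrite val_SyzD !val_SyzZ.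
have l'i : l' != i by apply: contraNneq l'NU => ->.
have l'l : l' != l by apply: contraNneq l'NU => ->.
have cU' : #|l' |: (U :\ l)| = r.+2.
  by rewrite cardsU1 (card_circuitD1 cU lU) !inE (negPf l'NU) andbF.
have iW : i \in l' |: U by rewrite !inE iU orbT.
have cV : #|(l' |: U) :\ i| = r.+2.
  by have := cardsD1 i (l' |: U); rewrite iW cardsU1 l'NU cU => -[].
have l'U' : l' \in l' |: (U :\ l) by rewrite !inE eqxx.
have iU' : i \in l' |: (U :\ l) by rewrite !inE iU (eq_sym i l) li orbT.
have lV : l \in (l' |: U) :\ i by rewrite !inE li lU orbT.
have l'V : l' \in (l' |: U) :\ i by rewrite !inE l'i eqxx.
rewrite (val_lin_Syz K cU lU iU) (val_lin_Syz K cU' l'U' iU').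
rewrite (val_lin_Syz K cV lV l'V) /lin_syz.
have -> : (l' |: U :\ l) :\ l' = U :\ l.
  by rewrite setU1K // !inE (negPf l'NU) andbF.
have -> : (l' |: U) :\ i :\ l' = U :\ i.
  apply/setP => k; rewrite !inE; case: (eqVneq k l') => [->|_] //=.
  by rewrite (negPf l'NU) andbF.
have -> : (l' |: U) :\ i :\ l = (l' |: U :\ l) :\ i.
  apply/setP => k; rewrite !inE; case: (eqVneq k l') => [->|_] /=.
    by rewrite l'l.
  by rewrite andbCA.
by rewrite -[X in _ = X + _](scale_exchange _ _ _ (gen_vec K r (U :\ l))) subrK.
Qed.

Lemma homog_restrict_im B psi : #|B| != 2%N ->
  homog_Hom (- mono_deg (mnm_set B)) psi ->
  psi \in restrict_im (n:=n) (Delta:=Delta).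
Proof.
(* For #B < 2 every U - B has more than r elements, so psi vanishes on all generators. *)
move=> B2 hpsi; have [Blt|Bge] := ltnP #|B| 2.
  suff -> : psi = 0 by exact: (rpred0 (restrict_im (n:=n) (Delta:=Delta))).
  apply: hom_val_ext => U cU; have /card_gt0P[i iU] : (0 < #|U|)%N by rewrite cU.
  exists i => // l lU _; rewrite [RHS](_ : _ = 0) //.
  have [_ psi0 _] := hom_lin_Syz_homog cU lU iU hpsi; apply: psi0.
  rewrite -(ltn_add2l #|U :&: B|) cardsID cU.
  by move: Blt (subset_leq_card (subsetIr U B)); clear; lia.
have {B2 Bge}B3 : (2 < #|B|)%N by rewrite ltn_neqAle eq_sym B2.
have cardUB U k : B \subset U -> (#|U| <= k.+3)%N -> (#|U :\: B| <= k)%N.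
  move=> sBU Uk; rewrite cardsD (setIidPr sBU) leq_subLR.
  by apply: leq_trans Uk _; rewrite -addn3 addnC leq_add2r.
have /card_gt0P[i iB] : (0 < #|B|)%N by apply: leq_trans B3.
pose c U l := SR_coeff (mnm_set (U :\: B)) (hom_val psi (lin_Syz K r U l i)).
(* The candidate weight of P uses an arbitrary l outside P; [muE] shows that the scalar does not
   depend on that choice. *)
pose mu P := if [pick l | l \notin P] is Some l then c (l |: P) l else 0.
have muE U l : #|U| = r.+2 -> l \in U -> l \notin B -> B \subset U ->
    mu (U :\ l) = c U l.
  move=> cU lU lNB sBU; have iU := subsetP sBU i iB.
  rewrite /mu; case: pickP => [l'|/(_ l)]; last by rewrite !inE eqxx.
  have li : l != i by apply: contraNneq lNB => ->.
  rewrite !inE negb_and negbK => /orP[/eqP ->|l'NU]; first by rewrite setD1K.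
  have l'l : l' != l by apply: contraNneq l'NU => ->.
  have l'i : l' != i by apply: contraNneq l'NU => ->.
  set U' := l' |: _; have cU' : #|U'| = r.+2.
    by rewrite cardsU1 (card_circuitD1 cU lU) !inE (negPf l'NU) andbF.
  have l'U' : l' \in U' by rewrite !inE eqxx.
  have iU' : i \in U' by rewrite !inE iU (eq_sym i l) li orbT.
  have sBU' : B \subset U'.
    apply/subsetP => k kB; rewrite !inE (subsetP sBU) // andbT.
    by apply/orP; right; apply: contraNneq lNB => <-.
  pose W := (l' |: U) :\: B.
  have Ur : (#|U :\: B| <= r)%N by rewrite cardUB // cU.
  have Ur' : (#|U' :\: B| <= r)%N by rewrite cardUB // cU'.
  (* Here #B > 2 enters: W is left from r + 3 elements, and x^W must survive in S/I for coefficients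
     to be compared. *)
  have Wr : (#|mnm_supp (mnm_set W)| <= r)%N.
    have sBW : B \subset l' |: U := subset_trans sBU (subsetUr _ _).
    by rewrite mnm_supp_set cardUB // cardsU1 l'NU cU.
  have [_ _ psiU] := hom_lin_Syz_homog cU lU iU hpsi.
  have [_ _ psiU'] := hom_lin_Syz_homog cU' l'U' iU' hpsi.
  have psiV : hom_val psi (lin_Syz K r ((l' |: U) :\ i) l l') = 0.
    apply: hom_lin_Syz_notsub hpsi _.
    - by have := cardsD1 i (l' |: U); rewrite !inE iU orbT cardsU1 l'NU cU => -[].
    - by rewrite !inE li lU orbT.
    - by rewrite !inE l'i eqxx.
    by apply/subsetPn; exists i; rewrite ?inE ?eqxx.
  have /(congr1 (hom_val psi)) := lin_Syz_exchange cU lU iU l'NU li.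
  rewrite hom_valD !hom_valZ psiV mulr0 add0r.
  rewrite (psiU sBU Ur) (psiU' sBU' Ur') -/(c U l) -/(c U' l') -!rmorphM.
  have l'W : l' \in W.
    by rewrite !inE eqxx andbT; apply: contra l'NU => /(subsetP sBU).
  have lW : l \in W by rewrite !inE lNB lU orbT.
  have XU : 'X_l' * (c U l *: 'X_[mnm_set (U :\: B)]) = c U l *: 'X_[mnm_set W] :> S.
    rewrite -scalerAr mulrC -mpolyXD (mnm_setD1 l'W).
    congr (_ *: 'X_[mnm_set _ + _]); apply/setP => k; rewrite !inE.
    by case: (eqVneq k l') => [->|_] //=; rewrite (negPf l'NU) andbF.
  have XU' : 'X_l * (c U' l' *: 'X_[mnm_set (U' :\: B)]) = c U' l' *: 'X_[mnm_set W] :> S.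
    rewrite -scalerAr mulrC -mpolyXD (mnm_setD1 lW).
    congr (_ *: 'X_[mnm_set _ + _]); apply/setP => k; rewrite !inE.
    case: (eqVneq k l') => [->|_] /=; first by rewrite l'l.
    by rewrite andbCA.
  rewrite XU XU' => /(congr1 (SR_coeff (mnm_set W))).
  by rewrite (SR_coeffE _ Wr) (SR_coeffE _ Wr) !mcoeffZ mcoeffX eqxx !mulr1.
apply/restrict_imP; exists (free_hom r (weight B mu)).
apply: hom_val_ext => U cU; have [sBU|BNU] := boolP (B \subset U); last first.
  have /card_gt0P[j jU] : (0 < #|U|)%N by rewrite cU.
  exists j => // l lU _; rewrite (hom_lin_Syz_notsub cU lU jU hpsi BNU).
  rewrite hom_val_free_hom (val_lin_Syz K cU lU jU) free_form_lin_syz //.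
  rewrite /weight !subsetD1 (negPf BNU) /= !mul0r subr0.
  by rewrite (rmorph0 cls).
have iU := subsetP sBU i iB; exists i => // l lU li.
rewrite hom_val_weight // sBU /=; case: ifPn => [lNB|].
  rewrite muE //; have [_ _ psiU] := hom_lin_Syz_homog cU lU iU hpsi.
  by apply: (psiU sBU); rewrite cardUB // cU.
by rewrite negbK => lB; apply: hom_lin_Syz_Kosz hpsi.
Qed.
End Vanishing.

(** * Supports of size two *)

Section FlagHoms.
Variables (K : fieldType) (n r : nat).
Local Notation Delta := (uniform_matroid n r).
Local Notation S := {mpoly K[n]}.
Local Notation Sm := 'rV[S]_(ngens Delta).
Local Notation SyzU := (Syz K Delta).
Local Notation HomU := (Hom_SyzKosz K Delta).
Local Notation cls := (@SR_class K n r).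
Implicit Types (psi : HomU) (z y : SyzU) (B P U f : {set 'I_n}) (a : S).

(** The universal property of Syz/Kosz: an S-linear map to S/I that kills the Koszul relations
    descends to the quotient. *)
Lemma exists_hom (F : SyzU -> SR_ring K Delta) :
    (forall a y z, F (a *: y + z) = cls a * F y + F z) ->
    (forall z, (exists v w : Sm,
       val z = (gen_map v : S) *: w - (gen_map w : S) *: v) -> F z = 0) ->
  {psi : HomU | forall z, hom_val psi z = F z}.
Proof.
move=> FZD FKgen.
have F0 : F 0 = 0.
  have := FZD 1 0 0; rewrite scaler0 addr0 (rmorph1 cls) mul1r.
  by rewrite -{1}[F 0]addr0 => /addrI <-.
have FK z : z \in @Kosz K n Delta -> F z = 0.
  move=> /genmodP[k [a [x [Xx ->]]]].
  elim/big_rec: _ => [|i v _ v0]; first exact: F0.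
  by rewrite FZD v0 (FKgen _ (Xx i)) mulr0 addr0.
pose G (x : SyzKosz K Delta) : (SR_ring K Delta)^o :=
  F (repr (x : quomod (@Kosz K n Delta))).
have GE z : G (Syz_class z) = F z.
  have /Syz_classP/FK : Syz_class (repr (Syz_class z : quomod (@Kosz K n Delta)))
    = Syz_class z by exact: quoproj_repr.
  rewrite -scaleN1r addrC FZD (rmorphN1 cls) mulN1r addrC => /subr0_eq <-.
  by [].
have Glin : linear G.
  move=> c x y; have [a ->] := quoring_proj_surj c.
  have [u ->] := Syz_class_surj x; have [v ->] := Syz_class_surj y.
  by rewrite -Syz_classZD !GE FZD.
by exists (mk_hom Glin) => z; apply: GE.
Qed.

(** Otherwise m + 1_P has support P, which contains no other circuit, so the term x^m e_P could not
    be cancelled in [gen_map]. *)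
Lemma syz_coord_supp z P m : #|P| = r.+1 -> m \in msupp (coord P (val z)) ->
  ~~ (mnm_supp m \subset P).
Proof.
case/gen_support_surj => j <-; rewrite coord_gen_support => mz.
apply/negP => smP; have /Syz_predP z0 := valP z.
have := congr1 (mcoeff (m + mnm_set (gen_support j))%MM) z0.
rewrite gen_mapE raddf_sum /= mcoeff0 (bigD1 j) //= big1 => [|k kj]; last first.
  rewrite mcoeffMX_le mnm_set_le mnm_suppD mnm_supp_set (setUidPr smP).
  case: ifP => // skj; case/eqP: kj; apply: (@gen_support_inj n r).
  by apply/eqP; rewrite eqEcard skj !card_gen_support /=.
rewrite addr0 mcoeffMX_le lem_addl addmK => /eqP.
by rewrite mcoeff_eq0 mz.
Qed.

(** The flag (f, l) encodes the generator with U = f :|: B and the removed element l; its circuit U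
    - l is (f - l) :|: B. *)
Definition flag B (x : {set 'I_n} * 'I_n) :=
  [&& #|x.1| == r, [disjoint x.1 & B] & x.2 \in x.1].

(** Designed to send the syzygy of f :|: B at l to x_l x^{f - l} = x^f. Other sets containing the
    circuit (f - l) :|: B add to it a variable outside f, which [kill_outside] removes. *)
Definition flag_form B f l (v : Sm) : S :=
  'X_[mnm_set (f :\ l)] * kill_outside f (coord (f :\ l :|: B) v).

Section OneFlag.
Variables (B f : {set 'I_n}) (l : 'I_n).
Hypotheses (cB : #|B| = 2%N) (fl : flag B (f, l)).

Let cf : #|f| = r. Proof. by case/and3P: fl => /eqP. Qed.
Let fB : [disjoint f & B]. Proof. by case/and3P: fl. Qed.
Let lf : l \in f. Proof. by case/and3P: fl. Qed.

Lemma flag_disjoint : [disjoint f :\ l & B].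
Proof. exact: disjointWl (subD1set f l) fB. Qed.

Lemma card_flag_circuit : #|f :\ l :|: B| = r.+1.
Proof.
have := cardsD1 l f; rewrite lf cf add1n => rE.
by rewrite cardsU (disjoint_setI0 flag_disjoint) cards0 subn0 cB rE addn2.
Qed.

(** A monomial kept by [kill_outside] has support in f, but by [syz_coord_supp] not in (f - l) :|:
    B; hence it contains l, and the factor x^{f - l} completes its support to f. *)
Lemma flag_form_supp z m : m \in msupp (flag_form B f l (val z)) -> mnm_supp m = f.
Proof.
move=> /mem_msuppM[m1 [m2 []]]; rewrite msuppX inE => /eqP ->.
move=> /mem_kill_outside[sm2 /(syz_coord_supp card_flag_circuit) nsm2] ->.
rewrite mnm_suppD mnm_supp_set; have [lm2|lNm2] := boolP (l \in mnm_supp m2).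
  apply/eqP; rewrite eqEsubset subUset subD1set sm2 /=.
  apply/subsetP => k kf; rewrite in_setU in_setD1 kf andbT.
  by case: (eqVneq k l) => [->|].
case/negP: nsm2; apply: subset_trans (subsetUl _ _).
by rewrite subsetD1 sm2.
Qed.

Lemma flag_formZD a (v w : Sm) :
  flag_form B f l (a *: v + w)
    = kill_outside f a * flag_form B f l v + flag_form B f l w.
Proof.
rewrite /flag_form coordZD rmorphD rmorphM /= mulrDr.
by rewrite mulrCA.
Qed.

(** Each monomial of [a - kill_outside f a] involves a variable outside f; times a monomial of
    support f it has more than r variables. So [flag_form] is S-linear modulo I on syzygies. *)
Lemma SR_class_kill_outside a z :
  cls (kill_outside f a * flag_form B f l (val z))
    = cls a * cls (flag_form B f l (val z)).
Proof.
rewrite -rmorphM; apply/eqP; rewrite eq_sym -subr_eq0 -rmorphB -mulrBl; apply/eqP.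
apply/SR_class_eq0/mem_SR_ideal => m /mem_msuppM[m1 [m2 [am1 zm2 ->]]].
rewrite mnm_suppD (flag_form_supp zm2) -cf proper_card // properE subsetUr /=.
by rewrite subUset subxx andbT (mem_sub_kill_outside am1).
Qed.

(** A circuit has r + 1 elements and does not fit in f. This is why the form kills Koszul
    relations. *)
Lemma kill_outside_gen_map (v : Sm) : kill_outside f (gen_map v : S) = 0.
Proof.
rewrite gen_mapE rmorph_sum big1 //= => j _; rewrite rmorphM /= kill_outsideX.
rewrite mnm_supp_set ifN ?mulr0 //; apply/negP => /subset_leq_card.
by rewrite card_gen_support cf ltnn.
Qed.

Lemma exists_flag_hom : {psi : HomU | forall z,
  hom_val psi z = cls (flag_form B f l (val z))}.
Proof.
apply: exists_hom => [a y z|z [v [w zE]]].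
  by rewrite val_SyzD val_SyzZ flag_formZD rmorphD /= SR_class_kill_outside.
rewrite zE /flag_form coordB !coordZ rmorphB !rmorphM /= !kill_outside_gen_map.
by rewrite !mul0r subrr (rmorph0 cls) mulr0.
Qed.
End OneFlag.

Fact flag_hom_subproof B x : {psi : HomU | #|B| = 2%N -> flag B x ->
  forall z, hom_val psi z = cls (flag_form B x.1 x.2 (val z))}.
Proof.
case: (eqVneq #|B| 2%N) => [cB|/eqP cB]; last by exists 0.
case: (boolP (flag B x)) => [fx|_]; last by exists 0.
have fx' : flag B (x.1, x.2) by case: x fx.
by have [psi psiE] := exists_flag_hom cB fx'; exists psi.
Qed.

Definition flag_hom B x : HomU := sval (flag_hom_subproof B x).

Section FlagHomValues.
Variables (B : {set 'I_n}) (i : 'I_n) (x : {set 'I_n} * 'I_n).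
Hypotheses (cB : #|B| = 2%N) (iB : i \in B) (fx : flag B x).

Lemma flag_homE z : hom_val (flag_hom B x) z = cls (flag_form B x.1 x.2 (val z)).
Proof. exact: svalP (flag_hom_subproof B x) cB fx z. Qed.

Lemma homog_flag_hom : homog_Hom (- mono_deg (mnm_set B)) (flag_hom B x).
Proof.
have fx' : flag B (x.1, x.2) by case: x fx.
move=> a _ [z hz ->]; exists (flag_form B x.1 x.2 (val z)); last exact: flag_homE.
move=> m /mem_msuppM[m1 [m2 []]]; rewrite msuppX inE => /eqP ->.
move=> /mem_kill_outside[_].
have [j jE] := gen_support_surj (card_flag_circuit cB fx').
rewrite -jE coord_gen_support => /hz + -> => m2E.
rewrite mono_degD m2E gen_degE jE mnm_setU ?(flag_disjoint fx') // mono_degD.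
by rewrite opprD addrA addrACA subrr add0r.
Qed.

(** Of the two circuits of the syzygy only U - l contains B. If it is the circuit of x, its
    coefficient x_l survives only for l in x.1, which forces x.2 = l and x.1 = U - B. *)
Lemma flag_hom_lin_Syz U l : #|U| = r.+2 -> l \in U -> l \notin B ->
  B \subset U ->
  hom_val (flag_hom B x) (lin_Syz K r U l i) =
  if x == (U :\: B, l) then cls 'X_[mnm_set (U :\: B)] else 0.
Proof.
have fx' : flag B (x.1, x.2) by case: x fx.
move=> cU lU lNB sBU; have iU := subsetP sBU i iB.
have [_ fB xf] := and3P fx.
rewrite flag_homE (val_lin_Syz K cU lU iU) /flag_form.
rewrite coord_lin_syz ?(card_flag_circuit cB fx') //.
have /negPf -> : x.1 :\ x.2 :|: B != U :\ i.
  by apply: contraTneq iB => /setP/(_ i); rewrite !inE iB eqxx orbT.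
rewrite mul0r subr0; case: eqVneq => [PE|PNE]; last first.
  rewrite mul0r rmorph0 mulr0 (rmorph0 cls) ifN //.
  apply: contra PNE => /eqP ->; apply/eqP/setP => k; rewrite !inE /=.
  have := subsetP sBU k; case: (eqVneq k l) => [->|_] /=.
    by rewrite (negPf lNB).
  by case: (k \in B) => [->|_] //; rewrite orbF.
rewrite mul1r kill_outsideX.
have -> : mnm_supp U_(l) = [set l] :> {set 'I_n}.
  by apply/setP => k; rewrite !inE mnm1E [k == l]eq_sym; case: (l == k).
rewrite sub1set; case: ifPn => [lx|lNx]; last first.
  rewrite mulr0 (rmorph0 cls) ifN //; apply: contra lNx => /eqP ->.
  by rewrite !inE lNB.
have xl : x.2 = l.
  apply/eqP; apply: contraT => xNl; have /setP/(_ l) := PE.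
  by rewrite !inE eq_sym xNl lx eqxx.
have xU : x.1 = U :\: B.
  apply/setP => k; rewrite !inE; have /setP/(_ k) := PE; rewrite !inE xl.
  case: (eqVneq k l) => [->|_] /=; first by rewrite lx lNB lU.
  have := disjointFr fB (_ : k \in x.1).
  by case: (k \in x.1) => [->|] //=; case: (k \in B).
have -> : x = (U :\: B, l) by case: x xl xU => ? ? /= -> ->.
by rewrite eqxx /= -mpolyXD -mnm_setD1 // !inE lNB.
Qed.
End FlagHomValues.
End FlagHoms.

Lemma hom_scaleDE (K : fieldType) n (Delta : {set {set 'I_n}})
    (c : SR_ring K Delta) (psi psi' : Hom_SyzKosz K Delta) x :
  hom_fun (c *: psi + psi') x = c * hom_fun psi x + hom_fun psi' x
    :> SR_ring K Delta.
Proof. by rewrite homsDE homsZE. Qed.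

Lemma free_homZD (K : fieldType) n (Delta : {set {set 'I_n}})
    (phi : Hom_free K Delta) (a : {mpoly K[n]}) v w :
  (hom_fun phi (a *: v + w) : SR_ring K Delta)
    = quoring_proj (@SR_ideal K n Delta) a * (hom_fun phi v : SR_ring K Delta)
      + (hom_fun phi w : SR_ring K Delta).
Proof.
etransitivity; first exact: (hom_fun_is_linear phi a v w).
by rewrite -(SR_ring_scaleE a (phi v)).
Qed.

Lemma free_homB (K : fieldType) n (Delta : {set {set 'I_n}})
    (phi : Hom_free K Delta) (a b : {mpoly K[n]}) v w :
  (hom_fun phi (a *: v - b *: w) : SR_ring K Delta)
    = quoring_proj (@SR_ideal K n Delta) a * (hom_fun phi v : SR_ring K Delta)
      - quoring_proj (@SR_ideal K n Delta) b * (hom_fun phi w : SR_ring K Delta).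
Proof.
have phi0 : (hom_fun phi 0 : SR_ring K Delta) = 0 by exact: raddf0.
rewrite free_homZD -scaleNr -[_ *: w]addr0 free_homZD phi0 addr0.
by rewrite rmorphN mulNr.
Qed.

(** * Linear combinations of flag homomorphisms *)

Section FlagCombinations.
Variables (K : fieldType) (n r : nat) (B : {set 'I_n}) (i : 'I_n).
Hypotheses (cB : #|B| = 2%N) (iB : i \in B).
Local Notation Delta := (uniform_matroid n r).
Local Notation HomU := (Hom_SyzKosz K Delta).
Local Notation cls := (@SR_class K n r).
Local Notation flag_hom := (@flag_hom K n r B).

Definition flags : {set {set 'I_n} * 'I_n} := [set x | flag r B x].
Implicit Types (g : 'rV[K]_#|flags|) (psi : HomU) (U : {set 'I_n}).

Definition flag_comb g : HomU :=
  \sum_j cls ((g 0 j)%:MP) *: flag_hom (enum_val j).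

Lemma flag_enum_val (j : 'I_#|flags|) : flag r B (enum_val j).
Proof. by have := enum_valP j; rewrite inE. Qed.

Lemma hom_val_scaleD (c : SR_ring K Delta) psi psi' z :
  hom_val (c *: psi + psi') z = c * hom_val psi z + hom_val psi' z.
Proof. exact: hom_scaleDE. Qed.

Lemma hom_val_flag_comb g z : hom_val (flag_comb g) z =
  \sum_j cls ((g 0 j)%:MP) * hom_val (flag_hom (enum_val j)) z.
Proof.
rewrite /flag_comb; elim/big_rec2: _ => [|j s psi _ <-]; first exact: erefl.
exact: hom_val_scaleD.
Qed.

Lemma flag_comb_notsub g U l k : #|U| = r.+2 -> l \in U -> k \in U ->
  ~~ (B \subset U) -> hom_val (flag_comb g) (lin_Syz K r U l k) = 0.
Proof.
move=> cU lU kU BNU; rewrite hom_val_flag_comb big1 // => j _.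
rewrite (hom_lin_Syz_notsub cU lU kU _ BNU) ?mulr0 //.
exact: homog_flag_hom cB (flag_enum_val j).
Qed.

Lemma flag_comb_Kosz g U l : #|U| = r.+2 -> l \in U -> i \in U -> l != i ->
  l \in B -> hom_val (flag_comb g) (lin_Syz K r U l i) = 0.
Proof.
move=> cU lU iU li lB; rewrite hom_val_flag_comb big1 // => j _.
rewrite (hom_lin_Syz_Kosz (B := B) cU lU iU li lB iB) ?mulr0 //.
exact: homog_flag_hom cB (flag_enum_val j).
Qed.

Lemma flag_comb_lin_Syz g U l j : #|U| = r.+2 -> l \in U -> l \notin B ->
  B \subset U -> enum_val j = (U :\: B, l) ->
  hom_val (flag_comb g) (lin_Syz K r U l i)
    = cls (g 0 j *: 'X_[mnm_set (U :\: B)]).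
Proof.
move=> cU lU lNB sBU jE; rewrite hom_val_flag_comb (bigD1 j) //= big1 => [|k kj].
  rewrite flag_hom_lin_Syz ?flag_enum_val // jE eqxx addr0 -rmorphM.
  by rewrite mul_mpolyC.
rewrite flag_hom_lin_Syz ?flag_enum_val // -jE (inj_eq enum_val_inj) (negPf kj).
by rewrite mulr0.
Qed.

Lemma exists_flag U l : #|U| = r.+2 -> l \in U -> l \notin B -> B \subset U ->
  exists j : 'I_#|flags|, enum_val j = (U :\: B, l).
Proof.
move=> cU lU lNB sBU; suff xF : (U :\: B, l) \in flags.
  by exists (enum_rank_in xF (U :\: B, l)); apply: enum_rankK_in.
rewrite inE /flag /= inE lNB lU cardsD (setIidPr sBU) cU cB subn2 /=.
rewrite eqxx /= andbT -setI_eq0; apply/eqP/setP => k; rewrite !inE.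
by case: (k \in B); rewrite ?andbF.
Qed.

Lemma flag_circuit j (U := (enum_val j).1 :|: B) :
  [/\ #|U| = r.+2, (enum_val j).2 \in U, (enum_val j).2 \notin B,
      B \subset U & U :\: B = (@enum_val _ (mem flags) j).1].
Proof.
have [/eqP cf fB lf] := and3P (flag_enum_val j).
split; rewrite ?subsetUr //.
- by rewrite cardsU (disjoint_setI0 fB) cards0 subn0 cf cB addn2.
- by rewrite inE lf.
- by rewrite (disjointFr fB lf).
by rewrite setDUl setDv setU0; apply/setDidPl.
Qed.

(** The coefficient at (f, l) is read off the value at the syzygy of f :|: B. Both sides vanish when
    B is not in U or l is in B, and agree on the remaining generators. *)
Lemma homog_flag_comb psi : homog_Hom (- mono_deg (mnm_set B)) psi ->
  exists g, psi = flag_comb g.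
Proof.
move=> hpsi; exists (\row_j SR_coeff (mnm_set (enum_val j).1)
  (hom_val psi (lin_Syz K r ((enum_val j).1 :|: B) (enum_val j).2 i))).
apply: hom_val_ext => U cU; have [sBU|BNU] := boolP (B \subset U); last first.
  have /card_gt0P[j jU] : (0 < #|U|)%N by rewrite cU.
  exists j => // l lU _; rewrite (hom_lin_Syz_notsub cU lU jU hpsi BNU).
  by rewrite flag_comb_notsub.
have iU := subsetP sBU i iB; exists i => // l lU li.
have [lB|lNB] := boolP (l \in B).
  by rewrite flag_comb_Kosz // (hom_lin_Syz_Kosz cU lU iU li lB iB hpsi).
have [j jE] := exists_flag cU lU lNB sBU.
rewrite (flag_comb_lin_Syz _ cU lU lNB sBU jE) mxE jE /=.
have -> : U :\: B :|: B = U.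
  by rewrite setUC -[X in X :|: _](setIidPr sBU) setID.
have [_ _ psiU] := hom_lin_Syz_homog cU lU iU hpsi.
by apply: (psiU sBU); rewrite cardsD (setIidPr sBU) cU cB subn2.
Qed.

Lemma flag_comb_restrict_im g :
  flag_comb g \in restrict_im (n:=n) (Delta:=Delta) <->
  exists mu : {set 'I_n} -> K,
    forall j, g 0 j = mu ((enum_val j).1 :\ (enum_val j).2).
Proof.
split=> [/restrict_imP[phi gE]|[mu gE]].
  (* The image of e_{U - l} under phi, with U - l = (f - l) :|: B, is seen only through its
     coefficient at x^{f - l}. *)
  exists (fun e => SR_coeff (mnm_set e) (phi (gen_vec K r (e :|: B)))) => j.
  have [] := flag_circuit j; set f := (enum_val j).1; set l := (enum_val j).2.
  set U := f :|: B => cU lU lNB sBU UB.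
  have [/eqP cf _ lf] := and3P (flag_enum_val j).
  have iU := subsetP sBU i iB.
  have jE : enum_val j = (U :\: B, l).
    by rewrite UB /f /l; case: (enum_val j).
  have := flag_comb_lin_Syz g cU lU lNB sBU jE.
  rewrite gE /hom_val restrictE (val_lin_Syz K cU lU iU) free_homB.
  have [p pE] := quoring_proj_surj (phi (gen_vec K r (U :\ l)) : SR_ring K Delta).
  have [q qE] := quoring_proj_surj (phi (gen_vec K r (U :\ i)) : SR_ring K Delta).
  have eE : f :\ l :|: B = U :\ l.
    rewrite setDUl; congr (_ :|: _); apply/esym/setDidPl.
    by rewrite disjoint_sym disjoints1.
  rewrite eE pE qE -!/(cls _) -!rmorphM -rmorphB.
  move=> /(congr1 (SR_coeff (mnm_set (U :\: B)))).
  have Ur : (#|mnm_supp (mnm_set (U :\: B))| <= r)%N by rewrite mnm_supp_set UB cf.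
  have er : (#|mnm_supp (mnm_set (f :\ l))| <= r)%N.
    by rewrite mnm_supp_set -cf subset_leq_card ?subD1set.
  rewrite (SR_coeffE _ Ur) (SR_coeffE _ Ur) (SR_coeffE _ er) => coefE.
  have {coefE} := coefE; rewrite mcoeffB mcoeffZ mcoeffX eqxx mulr1 => <-.
  rewrite ![_ * p]mulrC ![_ * q]mulrC UB (mnm_setD1 lf) addmC mcoeffMX.
  (* The x_i term has no coefficient at x^f, because i is in B and f avoids B. *)
  rewrite mcoeffMX_le ifN ?subr0 //.
  apply/negP => /mnm_lepP/(_ i); rewrite mnmDE !mnm1E eqxx mnmE !inE.
  have iNf : i \notin f by rewrite -UB inE iB.
  have /negPf -> : l != i by apply: contraNneq lNB => ->.
  by rewrite (negPf iNf) andbF.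
(* Conversely, mu prescribes the weights: for P = U - l one has P - B = f - l. *)
apply/restrict_imP; exists (free_hom r (weight B (fun P => mu (P :\: B)))).
apply: hom_val_ext => U cU; have [sBU|BNU] := boolP (B \subset U); last first.
  have /card_gt0P[j jU] : (0 < #|U|)%N by rewrite cU.
  exists j => // l lU _; rewrite (flag_comb_notsub _ cU lU jU BNU).
  rewrite hom_val_free_hom (val_lin_Syz K cU lU jU) free_form_lin_syz //.
  by rewrite /weight !subsetD1 (negPf BNU) /= !mul0r subr0 (rmorph0 cls).
have iU := subsetP sBU i iB; exists i => // l lU li.
rewrite hom_val_weight // sBU /=; case: ifPn => [lNB|]; last first.
  by rewrite negbK; apply: flag_comb_Kosz.
have [j jE] := exists_flag cU lU lNB sBU.
rewrite (flag_comb_lin_Syz _ cU lU lNB sBU jE) gE jE /=.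
by congr (cls (mu _ *: _)); apply/setP => k; rewrite !inE andbCA.
Qed.
End FlagCombinations.

(** * Dimensions *)

Section Dimension.
Variables (K : fieldType) (V : lmodType K).

Lemma has_dim0 : (forall v : V, v = 0) -> has_dim 0 V.
Proof.
move=> V0; constructor; exists (fun _ => 0).
  by move=> a u v; rewrite scaler0 addr0.
by exists (fun _ => 0) => u; [rewrite (V0 u) | rewrite [u]thinmx0].
Qed.

Lemma has_dim_eq0 d : has_dim d V -> (d = 0%N <-> forall v : V, v = 0).
Proof.
case=> -[h hlin [h' hK h'K]]; split=> [d0 v|V0].
  apply: (can_inj hK); move: (h v) (h 0); rewrite d0 => x y.
  by rewrite [x]thinmx0 [y]thinmx0.
case: d h hlin h' hK h'K => // d h hlin h' hK h'K.
have /rowP/(_ 0) : const_mx 1 = 0 :> 'rV[K]_d.+1.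
  by apply: (can_inj h'K); rewrite [LHS]V0 [RHS]V0.
by rewrite !mxE => /eqP; rewrite oner_eq0.
Qed.

(** V is K^N modulo the row space of A, so a complement of that row space, of dimension N - M, gives
    coordinates. *)
Lemma has_dim_span N M (t : 'I_N -> V) (A : 'M[K]_(M, N)) :
    row_free A ->
    (forall v, exists g : 'rV_N, v = \sum_j g 0 j *: t j) ->
    (forall g : 'rV_N,
       \sum_j g 0 j *: t j = 0 <-> exists mu : 'rV_M, g = mu *m A) ->
  has_dim (N - M) V.
Proof.
move=> freeA span rel.
pose L (g : 'rV_N) := \sum_j g 0 j *: t j.
have Llin : linear L.
  move=> a g g'; rewrite /L scaler_sumr -big_split; apply: eq_bigr => j _.
  by rewrite !mxE scalerDl scalerA.
pose C := row_base (A^C)%MS.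
have Csurj v : exists u : 'rV_(\rank (A^C)%MS), v = L (u *m C).
  have [g ->] := span v.
  have /sub_addsmxP[[x y] /= gE] : (g <= A + A^C)%MS.
    exact: submx_full (addsmx_compl_full A).
  have /submxP[u uE] : (y *m A^C <= C)%MS by rewrite eq_row_base submxMl.
  exists u; rewrite gE uE -[x *m A]scale1r -/(L _) Llin scale1r.
  by rewrite [L (x *m A)](rel _).2 ?add0r //; exists x.
have LC0 u : L (u *m C) = 0 -> u = 0.
  move=> /rel[mu uE]; apply/eqP; rewrite -(mulmx_free_eq0 u (row_base_free _)).
  rewrite -/C -submx0 -(capmx_compl A) sub_capmx {1}uE submxMl /=.
  by rewrite -(eq_row_base (A^C)%MS) submxMl.
have CE : \rank (A^C)%MS = (N - M)%N.
  by rewrite mxrank_compl; move/eqP: freeA => ->.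
have [h hE] := choice Csurj.
have hP v u : v = L (u *m C) -> h v = u.
  move=> vE; apply/eqP; rewrite -subr_eq0; apply/eqP/LC0.
  by rewrite mulmxBl addrC -scaleN1r Llin -hE -vE scaleN1r addNr.
rewrite -CE; constructor; exists h.
  by move=> a u v; apply: hP; rewrite mulmxDl -scalemxAl Llin -!hE.
by exists (fun u => L (u *m C)) => [v|u]; [rewrite -hE | apply: hP].
Qed.
End Dimension.

(** * Classes in a graded component of T^2 *)

Section DegreeComponents.
Variables (K : fieldType) (n : nat) (Delta : {set {set 'I_n}}) (c : 'rV[int]_n).
Local Notation HomD := (Hom_SyzKosz K Delta).
Local Notation T2c := (T2_deg K Delta c).

Definition restrict_submod : submodClosed HomD := @restrict_im K n Delta.
Definition Hom_class (psi : HomD) : T2_over_K K Delta :=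
  (quoproj restrict_submod psi : T2 K Delta).

Lemma T2_deg_repr (t : T2c) :
  exists2 psi : HomD, homog_Hom c psi & val t = Hom_class psi.
Proof. by have /homog_T2P := valP t. Qed.

Lemma Hom_classZD (a : K) (psi psi' : HomD) :
  Hom_class (quoring_proj (@SR_ideal K n Delta) a%:MP *: psi + psi')
    = a *: Hom_class psi + Hom_class psi'.
Proof.
rewrite /Hom_class raddfD.
etransitivity; last exact: erefl.
exact: (congr1 (+%R^~ (quoproj restrict_submod psi'))
               (quoproj_is_scalable restrict_submod _ psi)).
Qed.

Lemma Hom_class0 : Hom_class 0 = 0.
Proof.
have := Hom_classZD 1 0 0; rewrite scaler0 addr0 scale1r.
by rewrite -{1}[Hom_class 0]addr0 => /addrI <-.
Qed.

Lemma Hom_class_eq0 (psi : HomD) :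
  Hom_class psi = 0 <-> psi \in @restrict_im K n Delta.
Proof.
have := quoproj_eq restrict_submod psi 0; rewrite subr0 => imE.
rewrite -Hom_class0 -[psi \in _]imE; split=> [psi0|/eqP psi0]; last exact: psi0.
by apply/eqP; exact: psi0.
Qed.

Lemma val_T2_degZD (a : K) (t s : T2c) : val (a *: t + s) = a *: val t + val s.
Proof. by rewrite submoduleDE submoduleZE. Qed.

Lemma val_T2_deg_inj (t s : T2c) : val t = val s -> t = s.
Proof. exact: val_inj. Qed.

Fact T2_class_subproof (psi : HomD) :
  {t : T2c | homog_Hom c psi -> val t = Hom_class psi}.
Proof.
case: (pselect (homog_Hom c psi)) => [hpsi|nh]; last by exists 0.
have tP : Hom_class psi \in homog_T2 c by apply/homog_T2P; exists psi.
by exists (exist (fun t => t \in homog_T2 c) _ tP).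
Qed.

Definition T2_class (psi : HomD) : T2c := sval (T2_class_subproof psi).

Lemma val_T2_class psi : homog_Hom c psi -> val (T2_class psi) = Hom_class psi.
Proof. exact: (svalP (T2_class_subproof psi)). Qed.

Lemma val_T2_class_sum N (psi : 'I_N -> HomD) (g : 'rV[K]_N) :
    (forall j, homog_Hom c (psi j)) ->
  val (\sum_j g 0 j *: T2_class (psi j))
    = Hom_class (\sum_j quoring_proj (@SR_ideal K n Delta) (g 0 j)%:MP *: psi j).
Proof.
move=> hpsi; elim/big_rec2: _ => [|j phi t _ tE].
  by rewrite Hom_class0.
by rewrite val_T2_degZD Hom_classZD tE val_T2_class.
Qed.

Lemma T2_deg_eq0 (t : T2c) :
  (forall psi : HomD, homog_Hom c psi -> psi \in @restrict_im K n Delta) -> t = 0.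
Proof.
move=> im; have [psi hpsi tE] := T2_deg_repr t.
by apply: val_T2_deg_inj; rewrite tE; apply/Hom_class_eq0/im.
Qed.
End DegreeComponents.

(** * Counting flags and ridges *)

Section UniformDimension.
Variables (K : fieldType) (n r : nat) (B : {set 'I_n}).
Local Notation Delta := (uniform_matroid n r).
Local Notation c := (- mono_deg (mnm_set B)).

Definition ridges : {set {set 'I_n}} :=
  [set e : {set 'I_n} | e \subset ~: B & #|e| == r.-1].

(** The incidence matrix of the map (f, l) -> f - l from flags to ridges; its row space consists of
    the functions on flags that factor through this map. *)
Definition ridge_mx : 'M[K]_(#|ridges|, #|flags r B|) :=
  \matrix_(e < #|ridges|, j < #|flags r B|)
    (@enum_val _ (mem ridges) e == (@enum_val _ (mem (flags r B)) j).1
       :\ (@enum_val _ (mem (flags r B)) j).2)%:R.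

Lemma card_setC_ord : #|~: B| = (n - #|B|)%N.
Proof. by have := cardsC B; rewrite card_ord; lia. Qed.

Lemma card_flags : #|flags r B| = (r * 'C(n - #|B|, r))%N.
Proof.
rewrite -card_setC_ord -cards_draws -sum1_card; set F := [set A | _].
rewrite (eq_bigl (fun x => (x.1 \in F) && (x.2 \in x.1))); last first.
  move=> [f l]; rewrite !inE /flag /= disjoints_subset andbA.
  by congr (_ && _); apply: andbC.
rewrite -(pair_big_dep (mem F) (fun f l => l \in f) (fun _ _ => 1%N)) /=.
rewrite (eq_bigr (fun _ => r)) ?sum_nat_const 1?mulnC // => f.
by rewrite inE => /andP[_ /eqP <-]; rewrite sum1_card.
Qed.

Lemma card_ridges : #|ridges| = 'C(n - #|B|, r.-1).
Proof.
by rewrite -card_setC_ord -cards_draws.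
Qed.

Lemma flag_ridge (x : {set 'I_n} * 'I_n) : x \in flags r B -> x.1 :\ x.2 \in ridges.
Proof.
rewrite !inE => /and3P[/eqP <- fB lf]; rewrite (cardsD1 x.2 x.1) lf eqxx andbT.
by rewrite -disjoints_subset (disjointWl (subD1set _ _) fB).
Qed.

(** As r - 1 + #B < n, some l lies outside e and B. The column of the flag (l |: e, l) has its only
    nonzero entry in row e. *)
Lemma ridge_mx_free : (0 < r)%N -> (r + #|B| <= n)%N -> row_free ridge_mx.
Proof.
move=> r0 rn; apply: inj_row_free => v v0; apply/rowP => e; rewrite mxE.
have := enum_valP e; rewrite inE => /andP[eB /eqP ce].
have [l lN] : exists l, l \notin enum_val e :|: B.
  apply/existsP; rewrite -negb_forall; apply/negP => /forallP all_in.
  have : (n <= #|enum_val e :|: B|)%N.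
    have sT : [set: 'I_n] \subset enum_val e :|: B.
      by apply/subsetP => k _; apply: all_in.
    by have := subset_leq_card sT; rewrite cardsT card_ord.
  rewrite cardsU ce; move: r0 rn; clear; lia.
rewrite inE negb_or in lN; case/andP: lN => lNe lNB.
have xF : (l |: enum_val e, l) \in flags r B.
  rewrite inE /flag /= setU11 andbT cardsU1 lNe ce add1n prednK // eqxx /=.
  by rewrite disjoints_subset subUset sub1set inE lNB.
have /rowP/(_ (enum_rank_in xF (l |: enum_val e, l))) := v0.
rewrite !mxE (bigD1 e) //= big1 => [|e' e'e]; last first.
  rewrite mxE enum_rankK_in //= setU1K // (inj_eq enum_val_inj) (negPf e'e).
  by rewrite mulr0.
by rewrite mxE enum_rankK_in //= setU1K // eqxx mulr1 addr0.
Qed.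

Lemma ridge_mx_span (g : 'rV[K]_#|flags r B|) :
  (exists mu : {set 'I_n} -> K,
     forall j, g 0 j = mu ((enum_val j).1 :\ (enum_val j).2)) <->
  exists mu : 'rV_#|ridges|, g = mu *m ridge_mx.
Proof.
split=> [[mu gE]|[mu ->]]; last first.
  exists (fun e => \sum_k mu 0 k * (@enum_val _ (mem ridges) k == e)%:R) => j.
  by rewrite mxE; apply: eq_bigr => k _; rewrite mxE.
exists (\row_(e < #|ridges|) mu (@enum_val _ (mem ridges) e)).
apply/rowP => j; rewrite gE mxE.
have eR := flag_ridge (enum_valP j).
rewrite (bigD1 (enum_rank_in eR ((enum_val j).1 :\ (enum_val j).2))) //= big1.
  by rewrite !mxE enum_rankK_in // eqxx mulr1 addr0.
move=> e ej; rewrite !mxE; case: eqP => [eE|_]; last by rewrite mulr0.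
by case/eqP: ej; apply: enum_val_inj; rewrite enum_rankK_in.
Qed.

Lemma has_dim_T2_deg_pair : (0 < r)%N -> (r + 2 <= n)%N -> #|B| = 2%N ->
  has_dim (r * 'C(n - 2, r) - 'C(n - 2, r.-1)) (T2_deg K Delta c).
Proof.
move=> r0 rn cB; have /card_gt0P[i iB] : (0 < #|B|)%N by rewrite cB.
rewrite -[in 'C(_, r)]cB -[in 'C(_, r.-1)]cB -card_flags -card_ridges.
have fhom j : homog_Hom c (flag_hom K r B (@enum_val _ (mem (flags r B)) j)).
  exact: homog_flag_hom cB (flag_enum_val j).
apply: (has_dim_span
  (t := fun j => T2_class c (flag_hom K r B (@enum_val _ (mem (flags r B)) j)))).
- by apply: ridge_mx_free; rewrite ?cB.
- move=> t; have [psi hpsi tE] := T2_deg_repr t.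
  have [g psiE] := homog_flag_comb cB iB hpsi; exists g.
  by apply: val_T2_deg_inj; rewrite val_T2_class_sum // tE psiE.
move=> g; rewrite -ridge_mx_span -(flag_comb_restrict_im cB iB g) -Hom_class_eq0.
have gE := val_T2_class_sum g fhom; split=> [g0|g0].
  by etransitivity; [exact: (esym gE) | rewrite g0].
by apply: val_T2_deg_inj; rewrite gE.
Qed.

Lemma T2_deg_uniform_eq0 (t : T2_deg K Delta c) :
  (#|B| != 2%N) || (n <= r + 1)%N -> t = 0.
Proof.
move=> h; apply: T2_deg_eq0 => psi hpsi; case/orP: h => [B2|nr].
  exact: homog_restrict_im hpsi.
(* For n <= r + 1 there is no set U of r + 2 elements, so [hom_val_ext] has nothing to check. *)
suff -> : psi = 0 by exact: (rpred0 (restrict_im (n:=n) (Delta:=Delta))).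
apply: hom_val_ext => U cU; have := max_card (mem U); rewrite card_ord cU => rn.
by move: nr rn; rewrite addn1; clear; lia.
Qed.
End UniformDimension.

(** This shows that the natural subtraction in [has_dim_T2_deg_pair] does not truncate, and gives
    the dimension as a product whose zeros are visible. *)
Lemma pair_bin_dim n r : (0 < r)%N -> (r + 2 <= n)%N ->
  (r * 'C(n - 2, r) = 'C(n - 2, r.-1) + (n - 2 - r) * 'C(n - 2, r.-1))%N.
Proof.
case: r => // s _ sn; rewrite mul_bin_left /= -mulSn; congr (_ * _)%N.
by move: sn; clear; lia.
Qed.

(** * Zero-one degrees and the vanishing criterion *)

Lemma zero_one_vector_mono_deg n (b : 'rV[int]_n) : zero_one_vector b ->
  b = mono_deg (mnm_set (vec_support b)).
Proof.
move=> b01; apply/rowP => i; rewrite mono_deg_set mxE inE.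
by case: (b01 i) => ->.
Qed.

Lemma mono_deg_zero_one n (B : {set 'I_n}) :
  zero_one_vector (mono_deg (mnm_set B)) /\ vec_support (mono_deg (mnm_set B)) = B.
Proof.
split=> [i|]; first by rewrite mono_deg_set mxE; case: (i \in B); [right|left].
by apply/setP => i; rewrite inE mono_deg_set mxE; case: (i \in B).
Qed.

Lemma T2_deg_uniform_dim (K : fieldType) n r (b : 'rV[int]_n) :
    (0 < r)%N -> zero_one_vector b ->
  has_dim (if (#|vec_support b| != 2%N) || (n <= r + 1)%N then 0%N
           else ((n - 2 - r) * 'C(n - 2, r.-1))%N)
    (T2_deg K (uniform_matroid n r) (- b)).
Proof.
move=> r0 /zero_one_vector_mono_deg bE; set B := vec_support b in bE *.
rewrite bE; case: ifPn => [cond|].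
  by apply: has_dim0 => t; apply: T2_deg_uniform_eq0.
rewrite negb_or negbK -ltnNge => /andP[/eqP cB rn].
have rn2 : (r + 2 <= n)%N by rewrite addnS.
have := @has_dim_T2_deg_pair K n r B r0 rn2 cB.
by rewrite pair_bin_dim // addKn.
Qed.

Lemma exists_card_set n k : (k <= n)%N -> exists F : {set 'I_n}, #|F| = k.
Proof.
move=> kn; have : (0 < #|[set A : {set 'I_n} | #|A| == k]|)%N.
  by rewrite card_draws card_ord bin_gt0.
by case/card_gt0P => F; rewrite inE => /eqP; exists F.
Qed.

(** For the converse, a face with n, n - 1 or n - 2 elements of the respective complex must have at
    most r elements. *)
Lemma uniform_matroid_corank n r : (1 <= r)%N -> (r <= n)%N ->
  (n <= r + 2)%N <->
    [\/ uniform_matroid n r = full_simplex n,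
        uniform_matroid n r = simplex_boundary n
      | (2 <= n)%N /\ uniform_matroid n r = uniform_matroid n (n - 2)].
Proof.
move=> r1 rn; split=> [nr|].
  have [rE|[rE|rE]] : r = n \/ (n = r.+1 \/ n = r.+2) by move: nr rn; clear; lia.
  - apply: Or31; apply/setP => F; rewrite !inE rE.
    by rewrite -[leqRHS]card_ord max_card.
  - apply: Or32; apply/setP => F; rewrite !inE properEcard subsetT cardsT card_ord.
    by apply/idP/idP; move: rE; clear; lia.
  apply: Or33; split; first by rewrite rE.
  by congr (uniform_matroid n _); move: rE; clear; lia.
case=> [UE|UE|[n2 UE]].
- have : [set: 'I_n] \in uniform_matroid n r by rewrite UE inE.
  by rewrite inE cardsT card_ord; clear; lia.
- have [F cF] := @exists_card_set n n.-1 (leq_pred n).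
  have : F \in uniform_matroid n r.
    rewrite UE inE properEcard subsetT cardsT card_ord cF.
    by move: r1 rn; clear; lia.
  by rewrite inE cF; clear; lia.
have [F cF] := @exists_card_set n (n - 2) (leq_subr 2 n).
have : F \in uniform_matroid n r by rewrite UE inE cF.
by rewrite inE cF; clear; lia.
Qed.

Theorem proposition4p1 (K : fieldType) (n r : nat)
    (n_gt0 : (0 < n)%N) (r_ge1 : (1 <= r)%N) (r_le_n : (r <= n)%N) :
  [/\ forall b : 'rV[int]_n, zero_one_vector b ->
        exists d : nat,
          has_dim d (T2_deg K (uniform_matroid n r) (- b)) /\
          d%:Z = (if (#|vec_support b| != 2%N) || (n <= r + 1)%N then 0
                  else r%:Z * 'C(n - 2, r)%:Z - 'C(n - 2, r - 1)%:Z),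
      (forall b : 'rV[int]_n, zero_one_vector b ->
         forall t : T2_deg K (uniform_matroid n r) (- b), t = 0)
        <-> (n <= r + 2)%N
    & (n <= r + 2)%N <->
        [\/ uniform_matroid n r = full_simplex n,
            uniform_matroid n r = simplex_boundary n
          | (2 <= n)%N /\ uniform_matroid n r = uniform_matroid n (n - 2)]].
Proof.
split; last exact: uniform_matroid_corank.
  move=> b b01; eexists; split; first exact: T2_deg_uniform_dim.
  case: ifPn => //; rewrite negb_or negbK -ltnNge => /andP[_ rn].
  have rn2 : (r + 2 <= n)%N by rewrite addnS.
  by rewrite -PoszM pair_bin_dim // subn1 PoszD addrC addKr.
split=> [T0|nr b b01].
  rewrite leqNgt; apply/negP => rn.
  have n2 : (2 <= n)%N by move: rn; clear; lia.
  (* Any pair B refutes vanishing: for r < n - 2 both factors of (n - 2 - r) C(n - 2, r - 1) are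
     positive. *)
  have [B cB] := exists_card_set n2.
  have [b01 bE] := mono_deg_zero_one B.
  have /has_dim_eq0[_ /(_ (T0 _ b01))] := @T2_deg_uniform_dim K n r _ r_ge1 b01.
  rewrite bE cB /=; case: ifPn => [|_ /eqP]; first by move: rn; clear; lia.
  have bin0 : (0 < 'C(n - 2, r.-1))%N.
    by rewrite bin_gt0; move: rn r_ge1; clear; lia.
  rewrite muln_eq0 [('C(_, _) == 0)%N]eqn0Ngt bin0 orbF.
  by move: rn; clear; lia.
have hd := @T2_deg_uniform_dim K n r _ r_ge1 b01.
apply/(has_dim_eq0 hd); case: ifPn => // _.
by have -> : (n - 2 - r = 0)%N by move: nr; clear; lia.
Qed.
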